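(* There is a universal constant $c_{\mathrm{bdg}}>0$ such that the following holds. Assume $Y\subset\mathbb{R}^d$ is bounded and that $(\sigma_*^2,\sigma^2,\alpha,\rho)$-goodness over $Y$ holds. For $t\ge 0$ define $$\widehat r_N(t):=\sigma\,\frac{4\sqrt3\,\gamma_2^{(\alpha)}(Y)+6\sqrt3\,\mathrm{diam}^{\alpha}(Y)\sqrt{1+\log(2|\mathcal I|+2)+t}}{\sqrt N},$$ $$\widehat\delta_N(t):=\begin{cases}\sigma_*\sqrt{\dfrac{6(1+\log(2|\mathcal I|+2)+t)}{N}}+\widehat r_N(t), & \mathcal I\ne\emptyset,\\ 0,&\mathcal I=\emptyset.\end{cases}$$ Let $\epsilon_0\ge 0$, $t\ge 0$, and let $\mathrm{Good}(\epsilon_0,t)$ be the event where all of the following hold: (a) $\widehat X\subset X_{\widehat\delta_N(t)}$, that is, feasible points of the SAA violate the ideal constraints by at most $\widehat\delta_N(t)$; (b) $\widehat X^{*,\epsilon_0}\subset X_{\widehat\delta_N(t)}^{*,\ \epsilon_0+2\widehat r_N(t)+\mathrm{gap}(-\widehat\delta_N(t))}$, i.e. every $x\in\widehat X$ with $\widehat F(x)\le\widehat F^*+\epsilon_0$ satisfies $f(x)\le f^*+\epsilon_0+\mathrm{gap}(-\widehat\delta_N(t))+2\widehat r_N(t)$ and $\max_{i\in\mathcal I}f_i(x)\le\widehat\delta_N(t)$; (c) $$|\widehat F^*-f^*|\le \widehat\delta_N(t)+\max\big\{2\widehat r_N(t)+\mathrm{gap}(-\widehat\delta_N(t)),\ \mathrm{gap}(\widehat\delta_N(t))\big\}.$$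 Then $\mathbb P(\mathrm{Good}(\epsilon_0,t))\ge 1-e^{-t}-2(|\mathcal I|+1)\rho$. If one assumes $(\sigma_*^2,\sigma^2,\alpha,p,\kappa_p)$-greatness over $Y$ instead of $(\sigma_*^2,\sigma^2,\alpha,\rho)$-goodness over $Y$, then one may take $\rho=(c_{\mathrm{bdg}}\,\kappa_p\sqrt{p/N})^p$ above. Finally, if in addition the feasible set is metrically regular, i.e. there is $\mathfrak c>0$ with $\mathrm{dist}(x,X)\le\mathfrak c\,\sup_{i\in\mathcal I}f_i(x)_+$ for all $x\in Y$ (a condition regarded as trivially satisfied when $\mathcal I=\emptyset$), then whenever $\mathrm{Good}(\epsilon_0,t)$ occurs, $\mathrm{dist}(x,X)\le\mathfrak c\,\widehat\delta_N(t)$ for all $x\in\widehat X$.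
   Context: Setting. $\|\cdot\|$ is a norm on $\mathbb R^d$; $\mathrm{diam}$ and $\mathrm{dist}(x,A)=\inf_{a\in A}\|x-a\|$ are taken in this norm; $a_+=\max\{a,0\}$. $\mathcal I$ is a finite (possibly empty) index set, $0\notin\mathcal I$, $\mathcal I_0=\mathcal I\cup\{0\}$. $(\Xi,\sigma(\Xi),\mathbf P)$ is a probability space and $\xi_1,\dots,\xi_N$ are i.i.d. with law $\mathbf P$, defined on $(\Omega,\mathcal A,\mathbb P)$. For a function $H$ on $\Xi$, $\mathbf E H=\int H\,d\mathbf P$ and $\widehat{\mathbf E}H=\frac1N\sum_{k=1}^N H(\xi_k)$. $Y\subset\mathbb R^d$, and for $i\in\mathcal I_0$, $F_i:Y\times\Xi\to\mathbb R$ is Carathéodory (measurable in $\xi$, continuous in $x$) with $\mathbf E|F_i(x,\cdot)|<\infty$ for all $x\in Y$; $f_i(x):=\mathbf E F_i(x,\cdot)$, $\widehat F_i(x):=\widehat{\mathbf E}F_i(x,\cdot)$, $f:=f_0$, $\widehat F:=\widehat F_0$. Ideal problem: for $\delta\in\mathbb R$, $X_\delta:=\{x\in Y: f_i(x)\le\delta\ \forall i\in\mathcal I\}$, $X:=X_0\neq\emptyset$ (so $X_\delta=Y$ if $\mathcal I=\emptyset$). $f^*:=\min_X f$ is assumed attained, and $x^*\in X$ is a fixed minimizer. $f^*_\delta:=\inf_{X_\delta}f$, $\mathrm{gap}(\delta):=|f^*_\delta-f^*|$ (convention: $\mathrm{gap}(\delta)=+\infty$ if $X_\delta=\emptyset$).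 $X_\delta^{*,\vartheta}:=\{x\in X_\delta: f(x)\le f^*+\vartheta\}$. Sample average approximation (SAA): $\widehat X:=\{x\in Y:\widehat F_i(x)\le0\ \forall i\in\mathcal I\}$, $\widehat F^*:=\min_{\widehat X}\widehat F$ (the SAA is assumed always to have a solution), $\widehat X^{*,\vartheta}:=\{x\in\widehat X:\widehat F(x)\le\widehat F^*+\vartheta\}$. Good and great functions. $h:\Xi\to\mathbb R_+$ is $(\sigma^2,\rho)$-good if $\mathbf E h\le\sigma^2$ and $\mathbb P\{\widehat{\mathbf E}h>2\sigma^2\}\le\rho$. For $p\ge2$, it is $(\sigma^2,p,\kappa_p)$-great if $\mathbf E h\le\sigma^2$ and $\|h(\xi)-\mathbf E h\|_{L^p}\le\kappa_p\sigma^2$ for $\xi\sim\mathbf P$. $(\sigma_*^2,\sigma^2,\alpha,\rho)$-goodness over a set $Z\subset Y$ with $x^*\in Z$ (where $\sigma^2,\sigma_*^2,\rho>0$, $\alpha\in(0,1]$) means: the $f_i$ and $F_i(\cdot,\xi)$, $i\in\mathcal I_0$, are continuous on $Y$; for each $i\in\mathcal I_0$ the function $\xi\mapsto(F_i(x^*,\xi)-f_i(x^* ))^2$ is $(\sigma_*^2,\rho)$-good; and for each $i\in\mathcal I_0$ there is $\mathsf L_i:\Xi\to\mathbb R$ such that $\mathsf L_i^2$ is $(\sigma^2,\rho)$-good and $|F_i(x,\xi)-F_i(x',\xi)|\le\mathsf L_i(\xi)\|x-x'\|^\alpha$ for all $x,x'\in Z$, $\xi\in\Xi$. $(\sigma_*^2,\sigma^2,\alpha,p,\kappa_p)$-greatness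 over $Z$ (with $p\ge 2$, $\kappa_p\ge1$) is the same with ''$(\sigma_*^2,\rho)$-good'', ''$(\sigma^2,\rho)$-good'' replaced by ''$(\sigma_*^2,p,\kappa_p)$-great'', ''$(\sigma^2,p,\kappa_p)$-great''. Generic chaining functional. For a metric space $(\mathcal M,\mathrm d)$, a sequence $\{\mathcal A_j\}_{j\ge0}$ of partitions of $\mathcal M$ is admissible if $|\mathcal A_0|=1$ and $|\mathcal A_j|\le2^{2^j}$ for $j\ge1$; $\mathrm{diam}(\mathcal A_j)$ is the largest diameter of a cell of $\mathcal A_j$; $\gamma_2^{(\alpha)}(\mathcal M):=\inf_{\{\mathcal A_j\}\text{ admissible}}\sum_{j\ge0}2^{j/2}\mathrm{diam}(\mathcal A_j)^\alpha$. Subsets of $\mathbb R^d$ carry the metric of $\|\cdot\|$.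
   Formalization: When the index set is empty, the bound in (c) gets the extra summand σ_*√(6(1+log(2|I|+2)+t)/N): without it (c) fails, e.g. for Y a single point, where r̂_N and both gaps vanish but the sample mean still fluctuates. *)

(* Defs.v *)
From mathcomp Require Export all_boot all_order all_algebra.
From mathcomp Require Export all_classical all_reals all_analysis.

Set Implicit Arguments.
Unset Strict Implicit.
Unset Printing Implicit Defensive.

Export Order.TTheory GRing.Theory Num.Theory.
Export numFieldNormedType.Exports.

#[export] Set Implicit Arguments.
#[export] Unset Strict Implicit.
#[export] Unset Printing Implicit Defensive.

Local Open Scope classical_set_scope.
Local Open Scope ring_scope.

(* Diameters, distances, optimal values and the chaining functional are extended
   reals, so that infinite suprema and infima of empty sets keep their meaning.
   Levels such as delta and theta are extended reals for the same reason. *)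
Section Geometry.
Context {R : realType}.

Definition is_norm (d : nat) (nrm : 'rV[R]_d -> R) : Prop :=
  [/\ forall x y, nrm (x + y) <= nrm x + nrm y,
      forall (a : R) x, nrm (a *: x) = `|a| * nrm x
    & forall x, nrm x = 0 -> x = 0].

(* The distance function is passed explicitly because 'rV[R]_d carries the sup
   norm as its canonical norm.  All norms on R^d induce its canonical topology,
   which is the one used for continuity. *)
Definition normd (d : nat) (nrm : 'rV[R]_d -> R) (x y : 'rV[R]_d) : R :=
  nrm (x - y).

Context {T : Type}.
Implicit Types (dst : T -> T -> R) (M A : set T).

Definition diam dst A : \bar R :=
  ereal_sup [set (dst x y)%:E | x in A & y in A].

Definition dist_to dst A (x : T) : \bar R :=
  ereal_inf [set (dst x a)%:E | a in A].

Definition mesh dst (C : set (set T)) : \bar R :=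
  ereal_sup [set diam dst c | c in C].

(* The partitions need not be nested. *)
Definition admissible M (A : nat -> set (set T)) : Prop :=
  [/\ forall j, partition (A j) id M,
      (A 0%N #= `I_1)%card
    & forall j, (1 <= j)%N -> (A j #<= `I_(2 ^ (2 ^ j)))%card].

Definition gamma2 (alpha : R) dst M : \bar R :=
  ereal_inf [set (\sum_(0 <= j <oo)
                    (2 `^ (j%:R / 2))%:E * mesh dst (A j) `^ alpha)%E
            | A in admissible M].

Definition is_minimizer (g : T -> R) A (x : T) : Prop :=
  A x /\ forall y, A y -> g x <= g y.

(* For the empty set this is +oo. *)
Definition optval (g : T -> R) A : \bar R := ereal_inf [set (g x)%:E | x in A].

(* Points of A whose g-value exceeds v by at most theta. *)
Definition near_opt (g : T -> R) A (v theta : \bar R) : set T :=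
  [set x | A x /\ ((g x)%:E <= v + theta)%E].

End Geometry.

Section Probability.
Context {R : realType} {dXi dOm : measure_display}.
Context {Xi : measurableType dXi} {Om : measurableType dOm}.
Context (P : probability Xi R) (Pr : probability Om R).
Context {N : nat} (xi : 'I_N -> {RV Pr >-> Xi}).

(* Taking A k := setT for some of the k gives the product rule over every
   subfamily. *)
Definition mutually_independent : Prop :=
  forall A : 'I_N -> set Xi, (forall k, measurable (A k)) ->
    Pr (\bigcap_k (xi k @^-1` A k)) = (\prod_(k < N) Pr (xi k @^-1` A k))%E.

Definition iid_with_law : Prop :=
  mutually_independent /\
  forall k A, measurable A -> distribution Pr (xi k) A = P A.

Definition emp_mean (H : Xi -> R) (w : Om) : R :=
  (\sum_(k < N) H (xi k w)) / N%:R.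

Definition good_fun (s2 rho : R) (h : Xi -> R) : Prop :=
  [/\ measurable_fun setT h,
      forall z, 0 <= h z,
      (\int[P]_z (h z)%:E <= s2%:E)%E
    & (Pr [set w | (2 * s2 < emp_mean h w)%R] <= rho%:E)%E].

Definition great_fun (s2 p kappa : R) (h : Xi -> R) : Prop :=
  [/\ measurable_fun setT h,
      forall z, 0 <= h z,
      (\int[P]_z (h z)%:E <= s2%:E)%E
    & ('N[P]_(p%:E)[(fun z => (h z - \int[P]_y h y)%:E)]
         <= (kappa * s2)%:E)%E].

(* Lower bound on the probability of an event that need not be measurable,
   through a measurable event that it contains; when B is measurable this is
   just b <= Pr B. *)
Definition prob_ge (B : set Om) (b : R) : Prop :=
  exists E : set Om, [/\ measurable E, E `<=` B & (b%:E <= Pr E)%E].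

End Probability.

(* In the families of functions indexed by option I, None is the objective and
   Some i, for i : I, are the constraints. *)
Section Programs.
Context {R : realType} {d : nat} {I : finType}.
Implicit Types (Y X : set 'rV[R]_d) (g : option I -> 'rV[R]_d -> R).

Definition feasible Y g (delta : \bar R) : set 'rV[R]_d :=
  [set x | Y x /\ forall i : I, ((g (Some i) x)%:E <= delta)%E].

Definition optimum Y g (delta : \bar R) : \bar R :=
  optval (g None) (feasible Y g delta).

(* Equal to +oo when the relaxed feasible set is empty. *)
Definition gap Y g (delta : \bar R) : \bar R :=
  `| optimum Y g delta - optimum Y g 0 |%E.

Definition metrically_regular (nrm : 'rV[R]_d -> R) Y g (c : R) : Prop :=
  forall x, Y x ->
    (dist_to (normd nrm) (feasible Y g 0) x
       <= (c * \big[Num.max/0]_(i : I) Num.max (g (Some i) x) 0)%:E)%E.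

End Programs.

Section SAA.
Context {R : realType} {dXi dOm : measure_display}.
Context {Xi : measurableType dXi} {Om : measurableType dOm}.
Context (P : probability Xi R) (Pr : probability Om R).
Context {N : nat} (xi : 'I_N -> {RV Pr >-> Xi}).
Context {d : nat} (nrm : 'rV[R]_d -> R) (Y : set 'rV[R]_d).
Context {I : finType} (F : option I -> 'rV[R]_d -> Xi -> R).

Definition caratheodory : Prop :=
  (forall i x, Y x -> measurable_fun setT (F i x)) /\
  (forall i z, {within Y, continuous (fun x => F i x z)}).

Definition mean_fun (i : option I) (x : 'rV[R]_d) : R := \int[P]_z F i x z.

Definition saa_fun (w : Om) (i : option I) (x : 'rV[R]_d) : R :=
  emp_mean xi (F i x) w.

(* The requirements common to goodness and greatness; Q2star and Q2 are the
   moment conditions put on the squares. *)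
Definition hoelder_over (Q2star Q2 : (Xi -> R) -> Prop) (alpha : R)
    (xstar : 'rV[R]_d) (Z : set 'rV[R]_d) : Prop :=
  [/\ Z `<=` Y /\ Z xstar,
      forall i, {within Y, continuous (mean_fun i)} /\
        forall z, {within Y, continuous (fun x => F i x z)},
      forall i, Q2star (fun z => (F i xstar z - mean_fun i xstar) ^+ 2)
    & forall i, exists L : Xi -> R,
        Q2 (fun z => L z ^+ 2) /\
        forall x x' z, Z x -> Z x' ->
          `|F i x z - F i x' z| <= L z * (normd nrm x x') `^ alpha].

Definition goodness_over (s2star s2 alpha rho : R) :=
  hoelder_over (good_fun P xi s2star rho) (good_fun P xi s2 rho) alpha.

Definition greatness_over (s2star s2 alpha p kappa : R) :=
  hoelder_over (great_fun P s2star p kappa) (great_fun P s2 p kappa) alpha.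

Context (sigmastar sigma alpha : R).

Definition log_term (t : R) : R := 1 + ln (2 * #|I|%:R + 2) + t.

Definition r_hat (t : R) : \bar R :=
  ((sigma / Num.sqrt N%:R)%:E *
     ((4 * Num.sqrt 3)%:E * gamma2 alpha (normd nrm) Y +
      (6 * Num.sqrt 3 * Num.sqrt (log_term t))%:E *
        diam (normd nrm) Y `^ alpha))%E.

Definition pointwise_dev (t : R) : R :=
  sigmastar * Num.sqrt (6 * log_term t / N%:R).

Definition delta_hat (t : R) : \bar R :=
  if #|I| == 0%N then 0%E else ((pointwise_dev t)%:E + r_hat t)%E.

(* Without constraints delta_hat is 0, so it does not account for the
   fluctuation of the objective at xstar.  That fluctuation cannot be dropped
   from a bound on the optimal value: if Y is one point then r_hat and both
   gaps vanish, whereas the optimal values differ by the deviation of an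
   empirical mean from its expectation. *)
Definition objective_dev (t : R) : R :=
  if #|I| == 0%N then pointwise_dev t else 0.

Definition Good (eps0 t : R) : set Om :=
  let f := mean_fun in
  let r := r_hat t in
  let delta := delta_hat t in
  [set w |
    let Xhat := feasible Y (saa_fun w) 0 in
    let Fhatstar := optimum Y (saa_fun w) 0 in
    let fstar := optimum Y f 0 in
    [/\ Xhat `<=` feasible Y f delta,
        near_opt (saa_fun w None) Xhat Fhatstar eps0%:E `<=`
          near_opt (f None) (feasible Y f delta) fstar
            (eps0%:E + 2%:E * r + gap Y f (- delta))
      & (`| Fhatstar - fstar | <=
           (objective_dev t)%:E + delta +
           maxe (2%:E * r + gap Y f (- delta)) (gap Y f delta))%E]].

End SAA.

(* Main.v *)
Require Import Defs.
From mathcomp Require Import measurable_realfun ring lra zify.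

(* Since exp(x - x^2/2) <= 1 + x + x^2/2, a function D with E D^2 <= v satisfies
   E exp(l (D - E D) - l^2 (D^2 + v)/2) <= 1. On the event where the empirical
   mean of D^2 is at most 2 v, which goodness provides, Chernoff's bound with a
   fixed l therefore gives
     P(empirical mean of D - E D > sqrt(6 v s / N)) <= exp(-s),
   without symmetrization and without the factor e that the radii leave room
   for. With s = log_term t this is used at xstar, where v = sigmastar^2, and for
   increments F(u) - F(v), where v = (sigma |u - v|^alpha)^2. The chain starts at
   the level m with s <= 2^m <= 2 s: the jump from xstar to level m is taken at
   confidence 18 s and the jumps from level j to j+1 at confidence 16 * 2^j. These
   produce exactly the constants 6 sqrt 3 and 4 sqrt 3, and the union bound over
   the chain costs only as much as the pointwise deviations, within the spare
   factor e. Greatness implies goodness by the Fuk-Nagaev truncation argument,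
   which replaces moment inequalities with constant sqrt p. *)

Local Open Scope classical_set_scope.
Local Open Scope ring_scope.

(** * Exponential inequalities *)

(** Goodness controls no tail of a single increment beyond its second moment; it only bounds the
    empirical mean of [L ^+ 2]. By the Hoelder condition this one event bounds the empirical mean
    squares of all increments at once, so each index pays [rho] only twice, for [xstar] and for [L],
    however many links the chain has. This is why the squares are kept in the exponent and not
    estimated link by link. The exceptional events of the chain belong to links between points of
    nets that are fixed in advance and finite at each level; hence their union is measurable and the
    same for all points [x], and no supremum over [Y] has to be measured. The remaining distance
    from [x] to its chain is handled without probability, through the same bound on [L ^+ 2]. Links
    are measured by the mesh of the finer of their two levels, which leaves the level-0 term of the
    chaining sum free. *)

Lemma expR_sub_sqr_le (R : realType) (x : R) :
  expR (x - x ^+ 2 / 2) <= 1 + x + x ^+ 2 / 2.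
Proof.
have h0 : 0 < 1 + x + x ^+ 2 / 2 by nra.
(* The reciprocal of the left side is at least 1 - x + x^2/2, and the product of the two quadratics
   is 1 + x^4/4. *)
have h1 : 1 - x + x ^+ 2 / 2 <= expR (- (x - x ^+ 2 / 2)).
  by apply: le_trans (expR_ge1Dx _); lra.
have h2 : 0 < 1 - x + x ^+ 2 / 2 by nra.
have -> : expR (x - x ^+ 2 / 2) = (expR (- (x - x ^+ 2 / 2)))^-1.
  by rewrite expRN invrK.
rewrite -[leRHS]invrK lef_pV2 ?posrE ?expR_gt0 ?invr_gt0 //.
apply: le_trans h1; rewrite invf_ple ?posrE //.
rewrite -[leLHS]mul1r ler_pdivrMr //.
have -> : (1 + x + x ^+ 2 / 2) * (1 - x + x ^+ 2 / 2) = 1 + (x ^+ 2) ^+ 2 / 4 by field.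
by have := sqr_ge0 (x ^+ 2); lra.
Qed.

(* e^y / y^2, rather than e^y alone, is what turns the truncation level into the
   right power in the Fuk-Nagaev bound. *)
Lemma expR_taylor2_le (R : realType) (x y : R) : x <= y -> 0 < y ->
  expR x <= 1 + x + 4 * expR 2 * (expR y / y ^+ 2) * x ^+ 2.
Proof.
move=> xy y0.
have sq (u : R) : 0 <= u -> (1 + u / 2) ^+ 2 <= expR u.
  move=> u0; have -> : expR u = expR (u / 2) ^+ 2.
    by rewrite -expRM_natl; congr expR; field.
  by rewrite lerXn2r ?nnegrE ?expR_ge0 ?expR_ge1Dx//; lra.
(* Hence e^y / y^2 >= 1/4, so the coefficient of x^2 is at least e^2, which is enough when x <=
   2. *)
have y4 : y ^+ 2 <= 4 * expR y by have := sq y (ltW y0); nra.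
have ky : 1 <= 4 * (expR y / y ^+ 2).
  by rewrite mulrA ler_pdivlMr ?exprn_gt0// mul1r.
have e2 : 1 <= expR (2 : R) by apply: le_trans (expR_ge1Dx _); lra.
have ky2 : 1 <= 4 * expR 2 * (expR y / y ^+ 2) by nra.
have x20 := sqr_ge0 x.
have small : x <= 2 -> expR x - 1 - x <= x ^+ 2 * expR 2.
  move=> x2; have [x0|x0] := leP 0 x.
    have h1 : expR x * (1 - x) <= 1.
      have : 1 - x <= expR (- x) by apply: le_trans (expR_ge1Dx _).
      by rewrite expRN => h; rewrite mulrC -ler_pdivlMr ?expR_gt0// mul1r.
    have : expR x <= expR 2 by rewrite ler_expR.
    by have := expR_gt0 x; nra.
  have [x1|x1] := leP (-1) x.
    have h1 : expR x * (1 - x) <= 1.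
      have : 1 - x <= expR (- x) by apply: le_trans (expR_ge1Dx _).
      by rewrite expRN => h; rewrite mulrC -ler_pdivlMr ?expR_gt0// mul1r.
    have : expR x <= 1 by rewrite -[leRHS]expR0 ler_expR ltW.
    by have := expR_gt0 x; nra.
  have : expR x <= 1 by rewrite -[leRHS]expR0 ler_expR ltW.
  by nra.
have [x2|x2] := leP x 2.
  have := small x2; have := expR_gt0 (2:R).
  set u := expR 2 in ky e2 *; set v := expR y / y ^+ 2 in ky *; move=> u0 h.
  have : x ^+ 2 * u <= 4 * u * v * x ^+ 2.
    rewrite [leLHS]mulrC ler_wpM2r// -mulrA mulrCA.
    by rewrite -[leLHS]mulr1 ler_wpM2l// ltW.
  lra.
(* Monotonicity of e^x / x^2 beyond 2: e^(y-x) >= (1 + (y-x)/2)^2 >= (y/x)^2, where the last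
   inequality amounts to (y-x)(x-2) >= 0. *)
have : expR x <= (expR y / y ^+ 2) * x ^+ 2.
  rewrite mulrAC ler_pdivlMr ?exprn_gt0//.
  have -> : expR y = expR x * expR (y - x) by rewrite -expRD; congr expR; ring.
  rewrite -mulrA ler_wpM2l ?expR_ge0//.
  apply: le_trans (_ : (1 + (y - x) / 2) ^+ 2 * x ^+ 2 <= _).
    have yx : y <= (1 + (y - x) / 2) * x.
      have : 0 <= (y - x) * (x - 2) by rewrite mulr_ge0; lra.
      lra.
    by rewrite -exprMn lerXn2r ?nnegrE//; lra.
  by rewrite ler_wpM2r// sq// subr_ge0.
have : 0 <= (expR y / y ^+ 2) * x ^+ 2 by rewrite mulr_ge0// divr_ge0 ?expR_ge0// sqr_ge0.
rewrite -(mulrA (4 * expR 2)); nra.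
Qed.

(** * Independent samples and exponential tails *)

Section IidProduct.
Context {R : realType} {dXi dOm : measure_display}.
Context {Xi : measurableType dXi} {Om : measurableType dOm}.
Context (P : probability Xi R) (Pr : probability Om R).
Local Open Scope ereal_scope.

Import HBNNSimple.

(* Independence is applied one coordinate at a time, with G the product of the
   remaining factors. *)
Lemma ge0_integral_comp_density (X : {RV Pr >-> Xi}) (G : Om -> R) (c : R) :
  measurable_fun setT G -> (forall w, 0 <= G w)%R ->
  (forall A, measurable A -> \int[Pr]_w (G w * \1_A (X w))%:E = c%:E * P A) ->
  forall g : Xi -> R, measurable_fun setT g -> (forall z, 0 <= g z)%R ->
  \int[Pr]_w (G w * g (X w))%:E = c%:E * \int[P]_z (g z)%:E.
Proof.
move=> mG G0 GA g mg g0.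
have mX : measurable_fun setT X by exact: measurable_funPT.
have mGh (h : Xi -> R) : measurable_fun setT h ->
    measurable_fun setT (fun w => (G w * h (X w))%:E).
  move=> mh; apply/measurable_EFinP; apply: measurable_funM => //.
  exact: measurableT_comp.
have simple (h : {nnsfun Xi >-> R}) :
    \int[Pr]_w (G w * h (X w))%:E = c%:E * \int[P]_z (h z)%:E.
  have mA y : measurable (h @^-1` [set y]) by [].
  have hE z : (h z)%:E = \sum_(y \in range h) (y%:E * (\1_(h @^-1` [set y]) z)%:E).
    by rewrite fimfunE -fsumEFin.
  have GhE w : (G w * h (X w))%:E =
      \sum_(y \in range h) (y%:E * (G w * \1_(h @^-1` [set y]) (X w))%:E).
    rewrite EFinM hE ge0_mule_fsumr; last by move=> y; exact: nnfun_muleindic_ge0.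
    by apply: eq_fsbigr => y _; rewrite muleCA EFinM.
  have G1 y w : 0 <= y%:E * (G w * \1_(h @^-1` [set y]) (X w))%:E.
    rewrite EFinM muleCA; apply: mule_ge0; first by rewrite lee_fin.
    exact: nnfun_muleindic_ge0.
  under eq_integral do rewrite GhE.
  rewrite ge0_integral_fsum//; last first.
    move=> y; apply: measurable_funeM; apply: mGh; exact: measurable_indic.
  under [in RHS]eq_integral do rewrite hE.
  rewrite ge0_integral_fsum//; last 2 first.
  - by move=> y; apply: measurable_funeM; apply/measurable_EFinP.
  - by move=> *; exact: nnfun_muleindic_ge0.
  rewrite ge0_mule_fsumr; last first.
    by move=> y; apply: integral_ge0 => z _; exact: nnfun_muleindic_ge0.
  apply: eq_fsbigr => y; rewrite inE => -[z _ hz].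
  have y0 : (0 <= y)%R by rewrite -hz fun_ge0.
  rewrite ge0_integralZl_EFin//; last 2 first.
  - by move=> w _; rewrite lee_fin mulr_ge0.
  - apply: mGh; exact: measurable_indic.
  rewrite GA// ge0_integralZl_EFin//; last first.
    by apply/measurable_EFinP; exact: measurable_indic.
  by rewrite integral_indic// setIT muleCA.
have mg' : measurable_fun [set: Xi] (EFin \o g) by exact/measurable_EFinP.
pose h := nnsfun_approx measurableT mg'.
have hg z : EFin \o h^~ z @ \oo --> (g z)%:E.
  by apply: (cvg_nnsfun_approx measurableT mg') => // x _; rewrite lee_fin.
have ndh z : {homo h ^~ z : m n / (m <= n)%N >-> (m <= n)%R}.
  by move=> m n mn; have /lefP := nd_nnsfun_approx measurableT mg' mn; apply.
have l1 : \int[Pr]_w (G w * h n (X w))%:E @[n --> \oo] -->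
    \int[Pr]_w (G w * g (X w))%:E.
  have -> : \int[Pr]_w (G w * g (X w))%:E =
      \int[Pr]_w limn (fun n => (G w * h n (X w))%:E).
    apply: eq_integral => w _; apply/esym/cvg_lim => //.
    rewrite EFinM; under eq_fun do rewrite EFinM.
    by apply: cvgeZl => //; exact: hg.
  apply: cvg_monotone_convergence => //.
  - by move=> n; exact: mGh.
  - by move=> n w _; rewrite lee_fin mulr_ge0.
  - by move=> w _ m n mn; rewrite lee_fin ler_wpM2l// ndh.
have l2 : \int[P]_z (h n z)%:E @[n --> \oo] --> \int[P]_z (g z)%:E.
  have -> : \int[P]_z (g z)%:E = \int[P]_z limn (fun n => (h n z)%:E).
    by apply: eq_integral => z _; apply/esym/cvg_lim => //; exact: hg.
  apply: cvg_monotone_convergence => //.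
  - by move=> n; exact/measurable_EFinP.
  - by move=> n z _; rewrite lee_fin.
  - by move=> z _ m n mn; rewrite lee_fin ndh.
rewrite -(cvg_lim (@ereal_hausdorff R) l1); apply: cvg_lim => //.
by under eq_fun do rewrite simple; exact: cvgeZl.
Qed.

Context {N : nat} (xi : 'I_N -> {RV Pr >-> Xi}).
Hypothesis xi_iid : iid_with_law P xi.

(** Indicators are exchanged for the functions [g k] one coordinate at a time. With indicators only,
    the formula is the definition of independence. Replacing one more indicator is
    [ge0_integral_comp_density], where the constant c is the product of the other integrals; it has
    to be a real number, whence the finiteness of the integrals. *)
Lemma iid_integral_prod (g : 'I_N -> Xi -> R) :
  (forall k, measurable_fun setT (g k)) -> (forall k z, 0 <= g k z)%R ->
  (forall k, \int[P]_z (g k z)%:E < +oo) ->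
  \int[Pr]_w (\prod_(k < N) g k (xi k w))%:E =
  \prod_(k < N) \int[P]_z (g k z)%:E.
Proof.
move: xi_iid => [ind law] mg g0 gfin.
have mixed (m : nat) : forall A : 'I_N -> set Xi, (forall k, measurable (A k)) ->
    \int[Pr]_w (\prod_(k < N) (if (k < m)%N then g k else \1_(A k)) (xi k w))%:E =
    \prod_(k < N) \int[P]_z ((if (k < m)%N then g k else \1_(A k)) z)%:E.
  elim: m => [|m IH] A mA /=.
    transitivity (Pr (\bigcap_k (xi k @^-1` A k))).
      rewrite -[LHS](_ : \int[Pr]_w (\1_(\bigcap_k (xi k @^-1` A k)) w)%:E = _).
        rewrite integral_indic ?setIT//; apply: fin_bigcap_measurable => //.
        by move=> k _; rewrite -[X in measurable X]setTI; exact: measurable_funPT.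
      apply: eq_integral => w _; congr EFin; rewrite indicE.
      case: (boolP (w \in _)) => [|]; rewrite ?inE.
        move=> wA; rewrite big1// => k _; rewrite indicE mem_set//.
        exact: wA.
      move=> /negP; rewrite inE => nwA.
      have [k nk] : exists k, ~ A k (xi k w).
        by apply/not_existsP => h; apply: nwA => k _; apply: contrapT; exact: h.
      by rewrite (bigD1 k)//= indicE memNset// mul0r.
    rewrite ind//; apply: eq_bigr => k _.
    by rewrite integral_indic// setIT; exact: law.
  have [Nm|mN] := leqP N m.
    rewrite [LHS](_ : _ = \int[Pr]_w (\prod_(k < N)
        (if (k < m)%N then g k else \1_(A k)) (xi k w))%:E); last first.
      apply: eq_integral => w _; congr EFin; apply: eq_bigr => k _.
      by rewrite (leq_trans (ltn_ord k) (leqW Nm)) (leq_trans (ltn_ord k) Nm).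
    rewrite IH//; apply: eq_bigr => k _.
    by rewrite (leq_trans (ltn_ord k) (leqW Nm)) (leq_trans (ltn_ord k) Nm).
  pose km := Ordinal mN.
  have ltS (k : 'I_N) : k != km -> (k < m.+1)%N = (k < m)%N.
    by move=> kkm; rewrite ltnS leq_eqVlt -[m]/(val km) val_eqE (negbTE kkm).
  pose h (k : 'I_N) : Xi -> R := if (k < m)%N then g k else \1_(A k).
  have mh k : measurable_fun setT (h k).
    by rewrite /h; case: ifP => _ //; exact: measurable_indic.
  have h0 k z : (0 <= h k z)%R by rewrite /h; case: ifP.
  have hfin k : \int[P]_z (h k z)%:E \is a fin_num.
    rewrite ge0_fin_numE; last by apply: integral_ge0 => z _; rewrite lee_fin.
    rewrite /h; case: ifP => // _.
    by rewrite integral_indic// setIT; apply: le_lt_trans (ltry 1); exact: probability_le1.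
  pose G (w : Om) : R := (\prod_(k < N | k != km) h k (xi k w))%R.
  pose c : R := (\prod_(k < N | k != km) fine (\int[P]_z (h k z)%:E))%R.
  have cE : c%:E = \prod_(k < N | k != km) \int[P]_z (h k z)%:E.
    by rewrite /c -prodEFin; apply: eq_bigr => k _; rewrite fineK.
  transitivity (\int[Pr]_w (G w * g km (xi km w))%:E).
    apply: eq_integral => w _; congr EFin; rewrite (bigD1 km)//= ltnSn mulrC.
    by congr (_ * _)%R; apply: eq_bigr => k kkm; rewrite ltS.
  transitivity (c%:E * \int[P]_z (g km z)%:E); last first.
    rewrite [RHS](bigD1 km)//= ltnSn muleC cE; congr (_ * _).
    by apply: eq_bigr => k kkm; rewrite ltS.
  apply: ge0_integral_comp_density => //.
  - rewrite /G; under eq_fun do rewrite -big_filter.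
    apply: measurable_prod => k _.
    exact: (measurableT_comp (mh k) (measurable_funPT (xi k))).
  - by move=> w; apply: prodr_ge0.
  (* The induction hypothesis holds for every family of sets, so the set of coordinate m can be
     varied freely while the others stay fixed. *)
  move=> B mB; pose A' (k : 'I_N) := if k == km then B else A k.
  have mA' k : measurable (A' k) by rewrite /A'; case: ifP.
  have A'km : A' km = B by rewrite /A' eqxx.
  have hA' k : k != km -> (if (k < m)%N then g k else \1_(A' k)) = h k :> (Xi -> R).
    by move=> kkm; rewrite /A' /h (negbTE kkm).
  have := IH A' mA'; rewrite [RHS](bigD1 km)//= ltnn.
  rewrite [X in _ = _ * X](eq_bigr (fun k => \int[P]_z (h k z)%:E)); last first.
    by move=> k kkm; rewrite hA'.
  rewrite -cE integral_indic// setIT A'km muleC => <-.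
  apply: eq_integral => w _; congr EFin; rewrite [RHS](bigD1 km)//= ltnn A'km mulrC.
  by congr (_ * _)%R; apply: eq_bigr => k kkm; rewrite -hA'.
transitivity (\int[Pr]_w (\prod_(k < N) (if (k < N)%N then g k else \1_(setT)) (xi k w))%:E).
  by apply: eq_integral => w _; congr EFin; apply: eq_bigr => k _; rewrite ltn_ord.
by rewrite (mixed N (fun=> setT))//; apply: eq_bigr => k _; rewrite ltn_ord.
Qed.
End IidProduct.

Section MeasurableComparison.
Context {R : realType} {d : measure_display} {T : measurableType d}.

Lemma measurable_set_le (f g : T -> R) :
  measurable_fun setT f -> measurable_fun setT g ->
  measurable [set x | f x <= g x].
Proof.
by move=> mf mg; rewrite -[X in measurable X]setTI; exact: measurable_fun_le.
Qed.

Lemma measurable_set_lt (f g : T -> R) :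
  measurable_fun setT f -> measurable_fun setT g ->
  measurable [set x | f x < g x].
Proof.
move=> mf mg; rewrite [X in measurable X](_ : _ = ~` [set x | g x <= f x]).
  by apply: measurableC; exact: measurable_set_le.
by apply/seteqP; split=> x /=; rewrite ltNge => /negP.
Qed.

End MeasurableComparison.

Section Tails.
Context {R : realType} {dXi dOm : measure_display}.
Context {Xi : measurableType dXi} {Om : measurableType dOm}.
Context (P : probability Xi R) (Pr : probability Om R).
Context {N : nat} (xi : 'I_N -> {RV Pr >-> Xi}).

Lemma measurable_emp_mean (H : Xi -> R) :
  measurable_fun setT H -> measurable_fun setT (emp_mean xi H).
Proof.
move=> mH; apply: measurable_funM => //; apply: measurable_sum => k.
exact: (measurableT_comp mH (measurable_funPT (xi k))).
Qed.

Lemma measurable_emp_mean_gt (a : R) (H : Xi -> R) :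
  measurable_fun setT H -> measurable [set w | a < emp_mean xi H w].
Proof.
move=> mH.
by apply: measurable_set_lt => //; exact: measurable_emp_mean.
Qed.

Lemma measurable_emp_mean_le (a : R) (H : Xi -> R) :
  measurable_fun setT H -> measurable [set w | emp_mean xi H w <= a].
Proof.
move=> mH.
by apply: measurable_set_le => //; exact: measurable_emp_mean.
Qed.

Hypothesis xi_iid : iid_with_law P xi.

Lemma iid_chernoff (phi : Xi -> R) (a : R) :
  measurable_fun setT phi -> (\int[P]_z (expR (phi z))%:E <= 1)%E ->
  (Pr [set w | (a <= \sum_(k < N) phi (xi k w))%R] <= (expR (- a))%:E)%E.
Proof.
move=> mphi int1; set S := [set w | _].
have msum : measurable_fun setT (fun w => \sum_(k < N) phi (xi k w)).
  apply: measurable_sum => k.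
  exact: (measurableT_comp mphi (measurable_funPT (xi k))).
have mS : measurable S.
  by apply: measurable_set_le.
have mexp : measurable_fun setT (fun z => expR (phi z)).
  exact: measurableT_comp.
have h1 : (\int[Pr]_w (\prod_(k < N) expR (phi (xi k w)))%:E <= 1)%E.
  rewrite (iid_integral_prod xi_iid (g := fun _ z => expR (phi z)))//; last first.
    by move=> k; apply: le_lt_trans int1 (ltry _).
  suff /andP[] : (0 <= \prod_(k < N) \int[P]_z (expR (phi z))%:E <= 1)%E by [].
  elim/big_ind : _ => [|x y /andP[x0 x1] /andP[y0 y1]|k _].
  - by rewrite lee01 lexx.
  - by rewrite mule_ge0//= -[leRHS]mule1 lee_pmul.
  - by rewrite int1 andbT integral_ge0// => z _; rewrite lee_fin expR_ge0.
have h2 : ((expR a)%:E * Pr S <= 1)%E.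
  apply: le_trans h1.
  rewrite -[X in (_ * X)%E](_ : (\int[Pr]_w (\1_S w)%:E = _)%E); last first.
    by rewrite integral_indic// setIT.
  rewrite -ge0_integralZl_EFin ?expR_ge0//; last exact/measurable_EFinP.
  apply: ge0_le_integral => //.
  - by apply: measurable_funeM; exact/measurable_EFinP.
  - apply/measurable_EFinP; apply: measurable_prod => k _.
    exact: (measurableT_comp mexp (measurable_funPT (xi k))).
  move=> w _; rewrite -EFinM lee_fin -expR_sum indicE.
  case: (boolP (w \in S)) => [|_]; last by rewrite mulr0 expR_ge0.
  by rewrite inE /S /= mulr1 ler_expR.
by rewrite expRN -[leRHS]mule1 lee_pdivlMl ?expR_gt0.
Qed.

(** Shared by the self-normalized and the truncated exponential moments: a pointwise quadratic bound
    on exp(phi) reduces the claim to the first two moments of D. The factor k is the exponential of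
    the constant part of phi. *)
Lemma integral_expR_le1 (D phi : Xi -> R) (l b v k : R) :
  measurable_fun setT D -> P.-integrable setT (EFin \o D) ->
  (\int[P]_z (D z ^+ 2)%:E <= v%:E)%E ->
  measurable_fun setT phi -> 0 <= b -> 0 < k ->
  (forall z, expR (phi z) <= k * (1 + l * D z + b * D z ^+ 2)) ->
  k * (1 + l * \int[P]_z D z + b * v) <= 1 ->
  (\int[P]_z (expR (phi z))%:E <= 1)%E.
Proof.
move=> mD iD D2 mphi b0 k0 phile kle; set m := (\int[P]_y D y)%R in kle.
have mE : (\int[P]_z (D z)%:E = m%:E)%E.
  by rewrite /m /Rintegral fineK//; exact: integrable_fin_num.
have mD2 : measurable_fun setT (fun z => D z ^+ 2) by exact: measurable_funX.
have iD2 : P.-integrable setT (fun z => (D z ^+ 2)%:E).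
  apply/integrableP; split; first exact/measurable_EFinP.
  apply: le_lt_trans (ltry v); apply: le_trans D2.
  by under eq_integral do rewrite gee0_abs ?lee_fin ?sqr_ge0//.
pose g z := 1 + l * D z + b * D z ^+ 2.
have mg : measurable_fun setT g.
  apply: measurable_funD; first apply: measurable_funD => //.
    exact: measurable_funM.
  exact: measurable_funM.
have g0 z : 0 <= g z.
  by rewrite -(pmulr_rge0 _ k0); exact: le_trans (expR_ge0 _) (phile z).
apply: le_trans (_ : (\int[P]_z (k * g z)%:E <= _)%E).
  apply: ge0_le_integral => //.
  - by apply/measurable_EFinP; exact: measurableT_comp.
  - by apply/measurable_EFinP; exact: measurable_funM.
  - by move=> z _; rewrite lee_fin.
under eq_integral do rewrite EFinM.
rewrite ge0_integralZl_EFin ?(ltW k0)//; last 2 first.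
- by move=> z _; rewrite lee_fin.
- exact/measurable_EFinP.
have gE : (\int[P]_z (g z)%:E <= (1 + l * m + b * v)%:E)%E.
  rewrite [leLHS](_ : _ = (1%:E + l%:E * m%:E + b%:E * \int[P]_z (D z ^+ 2)%:E)%E).
    by rewrite !EFinD !EFinM leeD// lee_wpmul2l.
  under eq_integral do rewrite /g 2!EFinD 2!EFinM.
  rewrite integralD//; last 2 first.
  - apply: integrableD => //; first exact: finite_measure_integrable_cst.
    exact: integrableZl.
  - exact: integrableZl.
  rewrite integralD//; last 2 first.
  - exact: finite_measure_integrable_cst.
  - exact: integrableZl.
  rewrite integral_cst//= probability_setT mule1 integralZl// mE.
  by rewrite integralZl.
apply: (@le_trans _ _ (k%:E * (1 + l * m + b * v)%:E)%E).
  by rewrite lee_wpmul2l// lee_fin ltW.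
by rewrite -EFinM lee_fin.
Qed.

Lemma self_normalized_mgf (D : Xi -> R) (v l : R) :
  measurable_fun setT D -> P.-integrable setT (EFin \o D) ->
  (\int[P]_z (D z ^+ 2)%:E <= v%:E)%E ->
  (\int[P]_z (expR (l * (D z - \int[P]_y D y)
                     - l ^+ 2 / 2 * (D z ^+ 2 + v)))%:E <= 1)%E.
Proof.
move=> mD iD D2; set m := (\int[P]_y D y)%R.
apply: (integral_expR_le1 (l := l) (b := l ^+ 2 / 2)
  (k := expR (- (l * m + l ^+ 2 / 2 * v))) mD iD D2).
- apply: measurable_funB; apply: measurable_funM => //.
    exact: measurable_funB.
  by apply: measurable_funD => //; exact: measurable_funX.
- by rewrite divr_ge0// sqr_ge0.
- exact: expR_gt0.
- move=> z.
  have -> : l * (D z - m) - l ^+ 2 / 2 * (D z ^+ 2 + v) =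
     - (l * m + l ^+ 2 / 2 * v) + ((l * D z) - (l * D z) ^+ 2 / 2) by field.
  rewrite expRD ler_wpM2l ?expR_ge0//.
  by apply: le_trans (expR_sub_sqr_le _) _; lra.
rewrite expRN mulrC ler_pdivrMr ?expR_gt0// mul1r -addrA.
exact: expR_ge1Dx.
Qed.

Lemma self_normalized_tail (D : Xi -> R) (v s : R) : (0 < N)%N ->
  measurable_fun setT D -> P.-integrable setT (EFin \o D) ->
  (\int[P]_z (D z ^+ 2)%:E <= v%:E)%E -> 0 < v -> 0 <= s ->
  (Pr [set w | (emp_mean xi (fun z => D z ^+ 2) w <= 2 * v)%R /\
       (Num.sqrt (6 * v * s / N%:R) < emp_mean xi D w - \int[P]_z D z)%R]
     <= (expR (- s))%:E)%E.
Proof.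
move=> N0 mD iD D2 v0 s0; set m := (\int[P]_z D z)%R.
set a := Num.sqrt _.
have n0 : 0 < N%:R :> R by rewrite ltr0n.
have a0 : 0 <= a by rewrite sqrtr_ge0.
have a2 : a ^+ 2 = 6 * v * s / N%:R.
  rewrite sqr_sqrtr//; apply: divr_ge0; last exact: ltW.
  by apply: mulr_ge0 => //; lra.
(* On the event the exponent per sample is at least l a - 3 v l^2 / 2, since the empirical second
   moment plus v is at most 3 v. This l maximizes it, with value a^2 / (6 v) = s / N, which is where
   the 6 in the radius comes from. *)
pose l := a / (3 * v).
have l0 : 0 <= l by rewrite divr_ge0//; lra.
pose phi z := l * (D z - m) - l ^+ 2 / 2 * (D z ^+ 2 + v).
have mphi : measurable_fun setT phi.
  apply: measurable_funB; apply: measurable_funM => //.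
    exact: measurable_funB.
  by apply: measurable_funD => //; exact: measurable_funX.
apply: le_trans (iid_chernoff s mphi (self_normalized_mgf l mD iD D2)).
apply: le_measure; rewrite ?inE.
- apply: measurableI; first by apply: measurable_emp_mean_le; exact: measurable_funX.
  apply: measurable_set_lt => //.
  by apply: measurable_funB => //; exact: measurable_emp_mean.
- apply: measurable_set_le => //.
  apply: measurable_sum => k.
  exact: (measurableT_comp mphi (measurable_funPT (xi k))).
move=> w /= [].
have sumE (H : Xi -> R) : \sum_(k < N) H (xi k w) = N%:R * emp_mean xi H w.
  by rewrite /emp_mean mulrCA divff ?gt_eqF// mulr1.
set q := emp_mean _ _ w; set e := emp_mean _ _ w => q2 ae.
have -> : \sum_(k < N) phi (xi k w) = N%:R * (l * (e - m) - l ^+ 2 / 2 * (q + v)).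
  rewrite /q /e /emp_mean /phi sumrB -!mulr_sumr sumrB big_split/= !sumr_const card_ord.
  by rewrite -[m *+ N]mulr_natl -[v *+ N]mulr_natl; field; rewrite gt_eqF.
have -> : s = N%:R * (l * a - l ^+ 2 / 2 * (3 * v)).
  have -> : l * a - l ^+ 2 / 2 * (3 * v) = a ^+ 2 / (6 * v).
    by rewrite /l; field; rewrite gt_eqF.
  by rewrite a2; field; rewrite !gt_eqF.
rewrite ler_pM2l//; have l20 := sqr_ge0 l.
have : l * a <= l * (e - m) by rewrite ler_wpM2l// ltW.
by nra.
Qed.

End Tails.

Lemma measure_bigsetU_le (R : realType) (d : measure_display)
    (T : measurableType d) (mu : {measure set T -> \bar R}) (J : eqType)
    (s : seq J) (B : J -> set T) (p : R) :
  (forall j, j \in s -> measurable (B j) /\ (mu (B j) <= p%:E)%E) ->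
  measurable (\big[setU/set0]_(j <- s) B j) /\
  (mu (\big[setU/set0]_(j <- s) B j) <= ((size s)%:R * p)%:E)%E.
Proof.
elim: s => [|j s IH] Bs; first by rewrite !big_nil measure0 mul0r.
have [mB pB] := Bs j (mem_head _ _).
have [ms ps] := IH (fun i si => Bs i (mem_behead (s := j :: s) si)).
rewrite !big_cons; split; first exact: measurableU.
apply: le_trans (measureU2 _ mB ms) _.
by rewrite /= -natr1 mulrDl mul1r addrC EFinD leeD.
Qed.

(** * Greatness implies goodness *)

Section GreatIsGood.
Context {R : realType} {dXi dOm : measure_display}.
Context {Xi : measurableType dXi} {Om : measurableType dOm}.
Context (P : probability Xi R) (Pr : probability Om R).
Context {N : nat} (xi : 'I_N -> {RV Pr >-> Xi}).
Hypotheses (N_gt0 : (0 < N)%N) (xi_iid : iid_with_law P xi).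

Lemma iid_pr_preimage (k : 'I_N) (A : set Xi) :
  measurable A -> Pr (xi k @^-1` A) = P A.
Proof. by case: xi_iid => _ h mA; exact: (h k A mA). Qed.

Lemma markov_powR (Z : Xi -> R) (p K a : R) : 0 < p -> 0 <= K -> 0 < a ->
  measurable_fun setT Z -> (\int[P]_z (`|Z z| `^ p)%:E <= (K `^ p)%:E)%E ->
  (P [set z | (a < Z z)%R] <= ((K / a) `^ p)%:E)%E.
Proof.
move=> p0 K0 a0 mZ Zp; set S := [set z | _].
have mS : measurable S by exact: measurable_set_lt.
have ap0 : 0 < a `^ p by exact: powR_gt0.
rewrite powRM// ?invr_ge0 ?(ltW a0)//.
have -> : a^-1 `^ p = (a `^ p)^-1 by rewrite -powR_inv1 ?(ltW a0)// powRAC powR_inv1// ltW.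
rewrite EFinM lee_pdivlMr//; apply: le_trans Zp.
rewrite muleC -[X in (_ * X)%E](_ : (\int[P]_z (\1_S z)%:E = _)%E); last first.
  by rewrite integral_indic// setIT.
rewrite -ge0_integralZl_EFin ?(ltW ap0)//; last exact/measurable_EFinP.
apply: ge0_le_integral => //.
- by move=> z _; apply: mule_ge0; rewrite lee_fin// ltW.
- by apply: measurable_funeM; exact/measurable_EFinP.
- apply/measurable_EFinP; apply: (@measurableT_comp _ _ _ _ _ _ (fun x => x `^ p)).
    exact: measurable_powR.
  exact: measurableT_comp.
move=> z _; rewrite -EFinM lee_fin indicE.
case: (boolP (z \in S)) => [|_]; last by rewrite mulr0 powR_ge0.
rewrite inE /S /= mulr1 => aZ; apply: ge0_ler_powR; rewrite ?nnegrE ?(ltW a0) ?(ltW p0)//.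
by apply: le_trans (ler_norm _); exact: ltW.
Qed.

(** With y = |Z| / K one has y^2 <= 1 + y^p pointwise, which gives the bound at the cost of a factor
    2 and without comparing L^p norms. *)
Lemma second_moment_le (Z : Xi -> R) (p K : R) : 2 <= p -> 0 < K ->
  measurable_fun setT Z -> (\int[P]_z (`|Z z| `^ p)%:E <= (K `^ p)%:E)%E ->
  (\int[P]_z (Z z ^+ 2)%:E <= (2 * K ^+ 2)%:E)%E.
Proof.
move=> p2 K0 mZ Zp.
have Kp0 : 0 < K `^ p by exact: powR_gt0.
have mZp : measurable_fun setT (fun z => `|Z z| `^ p).
  apply: (@measurableT_comp _ _ _ _ _ _ (fun x => x `^ p)).
    exact: measurable_powR.
  exact: measurableT_comp.
have c0 : 0 <= K ^+ 2 / K `^ p by rewrite divr_ge0 ?sqr_ge0 ?ltW.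
apply: le_trans (_ : (\int[P]_z ((K ^+ 2)%:E + (K ^+ 2 / K `^ p)%:E * (`|Z z| `^ p)%:E) <= _)%E).
  apply: ge0_le_integral => //.
  - by move=> z _; rewrite lee_fin sqr_ge0.
  - by apply/measurable_EFinP; exact: measurable_funX.
  - apply: emeasurable_funD => //; apply: measurable_funeM; exact/measurable_EFinP.
  move=> z _; rewrite -EFinM -EFinD lee_fin.
  have -> : K ^+ 2 / K `^ p * `|Z z| `^ p = K ^+ 2 * (`|Z z| / K) `^ p.
    rewrite powRM// ?invr_ge0 ?(ltW K0)//.
    have -> : K^-1 `^ p = (K `^ p)^-1 by rewrite -powR_inv1 ?(ltW K0)// powRAC powR_inv1// ltW.
    by rewrite mulrAC mulrA.
  have -> : Z z ^+ 2 = K ^+ 2 * (`|Z z| / K) ^+ 2.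
    by rewrite expr_div_n real_normK ?num_real//; field; rewrite gt_eqF.
  rewrite -[X in X + _]mulr1 -mulrDr ler_wpM2l ?sqr_ge0//.
  set y := `|Z z| / K; have y0 : 0 <= y by rewrite divr_ge0// ltW.
  have [y1|y1] := leP y 1.
    by rewrite (le_trans (exprn_ile1 _ y0 y1))// lerDl powR_ge0.
  rewrite -powR_mulrn//; apply: le_trans (_ : y `^ p <= _); last by rewrite lerDr.
  by apply: ler_powR => //; exact: ltW.
rewrite ge0_integralD//; last 3 first.
- by move=> z _; rewrite lee_fin sqr_ge0.
- by move=> z _; apply: mule_ge0; rewrite lee_fin// powR_ge0.
- by apply: measurable_funeM; exact/measurable_EFinP.
rewrite integral_cst//= probability_setT mule1 ge0_integralZl_EFin//; last first.
  exact/measurable_EFinP.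
have -> : 2 * K ^+ 2 = K ^+ 2 + K ^+ 2 / K `^ p * K `^ p.
  by rewrite divfK ?gt_eqF//; ring.
by rewrite EFinD; apply: leeD => //; rewrite [leRHS]EFinM; exact: lee_wpmul2l.
Qed.

(* Fuk-Nagaev: truncate Z at tau = 2 N x / p, bound the maximum by Markov and
   the truncated sum by Bennett's exponential moment. *)
Lemma fuk_nagaev_tail (Z : Xi -> R) (p K x : R) :
  2 <= p -> 0 < x -> x <= K ->
  measurable_fun setT Z -> P.-integrable setT (EFin \o Z) ->
  \int[P]_z Z z = 0 -> (\int[P]_z (`|Z z| `^ p)%:E <= (K `^ p)%:E)%E ->
  (Pr [set w | (x < emp_mean xi Z w)%R] <=
     ((4 * expR 2 * (K / x) * Num.sqrt (p / N%:R)) `^ p)%:E)%E.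
Proof.
move=> p2 x0 xK mZ iZ Z0 Zp.
have n0 : 0 < N%:R :> R by rewrite ltr0n.
have p0 : 0 < p by lra.
have K0 : 0 < K by lra.
set u : R := K / x * Num.sqrt (p / N%:R).
have u0 : 0 < u by rewrite mulr_gt0 ?divr_gt0// sqrtr_gt0 divr_gt0.
have u2 : u ^+ 2 = (K / x) ^+ 2 * (p / N%:R).
  by rewrite exprMn sqr_sqrtr// divr_ge0// ltW.
have e1 : 1 <= expR (1 : R) by rewrite -[leLHS]expR0 ler_expR.
have e2E : expR 2 = expR 1 * expR 1 :> R by rewrite -expRD.
(* In terms of q the claim is the bound (2 q e)^p, which leaves (q e)^p for each of the two
   exceptional events. The factor 2 e in q makes N b = p / 2 below. *)
set q := 2 * expR 1 * u.
have q0 : 0 < q by rewrite /q mulr_gt0// mulr_gt0// expR_gt0.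
have -> : 4 * expR 2 * (K / x) * Num.sqrt (p / N%:R) = 2 * (q * expR 1).
  by rewrite /q /u e2E; ring.
set S := [set w | _].
have mS : measurable S by exact: measurable_emp_mean_gt.
(* For q >= 1 the claimed bound is at least 1. *)
have [q1|q1] := leP 1 q.
  apply: le_trans (probability_le1 Pr mS) _; rewrite lee_fin.
  apply: (@le_trans _ _ (1 `^ p)); first by rewrite powR1.
  apply: ge0_ler_powR; rewrite ?nnegrE ?(ltW p0)//; nra.
have u1 : u < 1 by move: q1; rewrite /q; nra.
have pN : p <= N%:R.
  suff : p / N%:R <= 1 by rewrite ler_pdivrMr// mul1r.
  have xK2 : 1 <= (K / x) ^+ 2.
    have : 1 <= K / x by rewrite ler_pdivlMr// mul1r.
    by nra.
  have : u ^+ 2 <= 1 by nra.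
  have : 0 <= p / N%:R by rewrite divr_ge0 ?ltW.
  by rewrite u2; nra.
set t := 2 * N%:R * x / p.
have t0 : 0 < t by rewrite divr_gt0// mulr_gt0// mulr_gt0.
(* The truncation level gives N l x = p y / 2, so the Chernoff exponent is a = p (y - 1) / 2; as e^y
   = q^-2, this makes exp(-a) equal to (q sqrt e)^p. *)
set y := - (2 * ln q).
have y0 : 0 < y by rewrite oppr_gt0 pmulr_rlt0// ln_lt0// q0.
have ey : expR y = (q ^+ 2)^-1.
  by rewrite /y expRN mulrC expRM_natr lnK.
set l := y / t; set b' := 4 * expR 2 * (expR y / t ^+ 2).
have l0 : 0 < l by rewrite divr_gt0.
have b'0 : 0 <= b'.
  apply: mulr_ge0; first by rewrite mulr_ge0 ?expR_ge0.
  by rewrite divr_ge0 ?expR_ge0 ?sqr_ge0.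
set b := b' * (2 * K ^+ 2).
pose phi z := l * Num.min (Z z) t - b.
have mphi : measurable_fun setT phi.
  apply: measurable_funB => //; apply: measurable_funM => //.
  exact: measurable_minr.
have int1 : (\int[P]_z (expR (phi z))%:E <= 1)%E.
  apply: (integral_expR_le1 (l := l) (b := b') (k := expR (- b)) mZ iZ
    (second_moment_le p2 K0 mZ Zp)) => //.
  - exact: expR_gt0.
  - move=> z; rewrite /phi addrC expRD ler_wpM2l ?expR_ge0//.
    have Wt : l * Num.min (Z z) t <= y.
      have -> : y = l * t by rewrite /l divfK ?gt_eqF.
      by rewrite ler_wpM2l ?(ltW l0)// ge_min lexx orbT.
    apply: le_trans (expR_taylor2_le Wt y0) _.
    (* Truncation from above at a positive level increases neither Z nor its square, so the moments
       of Z itself suffice. *)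
    rewrite -!addrA lerD2l; apply: lerD.
      by rewrite ler_wpM2l ?(ltW l0)// ge_min lexx.
    have -> : 4 * expR 2 * (expR y / y ^+ 2) * (l * Num.min (Z z) t) ^+ 2 =
        b' * Num.min (Z z) t ^+ 2.
      by rewrite /b' /l; field; rewrite !gt_eqF.
    rewrite ler_wpM2l// -[leRHS]real_normK ?num_real// -[leLHS]real_normK ?num_real//.
    rewrite lerXn2r ?nnegrE//; case: (leP (Z z) t) => // tZ.
    by rewrite !gtr0_norm// ?(lt_trans t0)// ltW.
  rewrite Z0 mulr0 addr0 expRN mulrC ler_pdivrMr ?expR_gt0// mul1r.
  exact: expR_ge1Dx.
pose a := N%:R * (l * x - b).
pose M k : set Om := [set w | (t < Z (xi k w))%R].
have mM k : measurable (M k).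
  by apply: measurable_set_lt => //; exact: (measurableT_comp mZ (measurable_funPT (xi k))).
pose U : set Om := \big[setU/set0]_(k <- enum 'I_N) M k.
have [mU Ule] : measurable U /\ (Pr U <= ((size (enum 'I_N))%:R * (K / t) `^ p)%:E)%E.
  apply: measure_bigsetU_le => k _; split; first exact: mM.
  rewrite [leLHS](iid_pr_preimage k (A := [set z | (t < Z z)%R])); last exact: measurable_set_lt.
  by apply: markov_powR => //; exact: ltW.
pose V : set Om := [set w | (a <= \sum_(k < N) phi (xi k w))%R].
have mV : measurable V.
  apply: measurable_set_le => //; apply: measurable_sum => k.
  exact: (measurableT_comp mphi (measurable_funPT (xi k))).
have SUV : S `<=` U `|` V.
  move=> w Sw; have [[k tk]|nM] := pselect (exists k, M k w).
    by left; rewrite /U -bigcup_seq; exists k => //=; rewrite mem_enum.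
  right; rewrite /V /= /phi /a.
  rewrite (eq_bigr (fun k => l * Z (xi k w) - b)); last first.
    move=> k _; congr (_ * _ - _); apply/min_idPl; rewrite leNgt.
    by apply/negP => tk; apply: nM; exists k.
  rewrite sumrB -mulr_sumr sumr_const card_ord -[b *+ N]mulr_natl mulrBr lerB//.
  rewrite mulrCA ler_wpM2l ?(ltW l0)//.
  by move: Sw; rewrite /S /= /emp_mean ltr_pdivlMr// mulrC => /ltW.
have Uq : (Pr U <= ((q * expR 1) `^ p)%:E)%E.
  apply: le_trans Ule _; rewrite lee_fin size_enum_ord.
  set w := p / N%:R.
  have w0 : 0 < w by rewrite divr_gt0.
  have -> : K / t = u / 2 * Num.sqrt w.
    have -> : u / 2 * Num.sqrt w = K / x / 2 * Num.sqrt w ^+ 2 by rewrite /u -/w; ring.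
    by rewrite sqr_sqrtr ?(ltW w0)// /w /t; field; rewrite !gt_eqF.
  rewrite powRM ?sqrtr_ge0 ?divr_ge0 ?(ltW u0)//.
  (* Here w = p / N <= 1 and p >= 2. The factor w cancels the N of the union bound and leaves p,
     which is at most e^p. *)
  have sw : Num.sqrt w `^ p <= w.
    rewrite -powR12_sqrt ?(ltW w0)// -powRrM.
    apply: ge1r_powR; first by rewrite w0 /w ler_pdivrMr ?mul1r.
    lra.
  have Nw : N%:R * w = p by rewrite /w mulrC divfK ?gt_eqF.
  apply: (@le_trans _ _ ((u / 2) `^ p * p)).
    by rewrite -[X in _ <= _ * X]Nw mulrCA ler_wpM2l ?powR_ge0// ler_wpM2l.
  apply: (@le_trans _ _ ((u / 2) `^ p * expR 1 `^ p)).
    rewrite ler_wpM2l ?powR_ge0// -expRM mul1r.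
    by apply: le_trans (expR_ge1Dx _); lra.
  rewrite -powRM ?expR_ge0 ?divr_ge0 ?(ltW u0)//.
  apply: ge0_ler_powR; rewrite ?nnegrE ?(ltW p0)//.
  - by rewrite mulr_ge0 ?expR_ge0 ?divr_ge0 ?(ltW u0).
  - by rewrite mulr_ge0 ?expR_ge0 ?(ltW q0).
  - by rewrite ler_wpM2r ?expR_ge0// /q; nra.
have Vq : (Pr V <= ((q * expR 1) `^ p)%:E)%E.
  apply: le_trans (iid_chernoff xi_iid a mphi int1) _; rewrite lee_fin.
  have aE : a = p / 2 * (y - 1).
    have -> : a = N%:R * (y / t) * x - N%:R * (4 * expR 2 * expR y * 2) * (K / t) ^+ 2.
      by rewrite /a /l /b /b'; field; rewrite gt_eqF.
    have -> : N%:R * (y / t) * x = p / 2 * y by rewrite /t; field; rewrite !gt_eqF.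
    have -> : N%:R * (4 * expR 2 * expR y * 2) * (K / t) ^+ 2 =
        2 * expR 2 * expR y * p * u ^+ 2.
      by rewrite u2 /t; field; rewrite !gt_eqF.
    rewrite ey e2E /q; field; rewrite !gt_eqF ?expR_gt0//.
  have qe0 : 0 < q * expR 1 by rewrite mulr_gt0 ?expR_gt0.
  rewrite /powR gt_eqF// ler_expR lnM ?posrE ?expR_gt0// expRK aE /y; nra.
apply: le_trans (le_measure _ _ _ SUV) _; rewrite ?inE//; first exact: measurableU.
apply: le_trans (measureU2 _ mU mV) _.
apply: le_trans (leeD Uq Vq) _; rewrite -EFinD lee_fin.
have qe0 : 0 <= q * expR 1 by rewrite mulr_ge0 ?expR_ge0 ?(ltW q0).
rewrite [leRHS]powRM//; have := powR_ge0 (q * expR 1) p.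
have : 2 `^ 1 <= 2 `^ p :> R by apply: ler_powR; lra.
by rewrite powRr1//; nra.
Qed.

(** As the mean of h is at most s2, an empirical mean above 2 s2 deviates from it by more than s2.
    The Fuk-Nagaev bound is applied at x = s2 with K = kappa s2, so that K / x = kappa. *)
Lemma great_fun_good (s2 p kappa : R) (h : Xi -> R) :
  0 < s2 -> 2 <= p -> 1 <= kappa -> great_fun P s2 p kappa h ->
  good_fun P xi s2 ((4 * expR 2 * kappa * Num.sqrt (p / N%:R)) `^ p) h.
Proof.
move=> s20 p2 k1 [mh h0 hs hp]; split => //.
have p0 : 0 < p by lra.
have n0 : 0 < N%:R :> R by rewrite ltr0n.
have ih : P.-integrable setT (EFin \o h).
  apply/integrableP; split; first exact/measurable_EFinP.
  apply: le_lt_trans (ltry s2); apply: le_trans hs.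
  by under eq_integral do rewrite gee0_abs ?lee_fin//.
set m := (\int[P]_y h y)%R in hp.
have mE : (\int[P]_z (h z)%:E = m%:E)%E.
  by rewrite /m /Rintegral fineK//; exact: integrable_fin_num.
have ms : m <= s2 by rewrite -lee_fin -mE.
pose Z z := h z - m.
have mZ : measurable_fun setT Z by exact: measurable_funB.
have iZ : P.-integrable setT (EFin \o Z).
  rewrite (_ : _ \o _ = (EFin \o h) \- (EFin \o cst m))%E//.
  by apply: integrableB => //; exact: finite_measure_integrable_cst.
have Z0 : \int[P]_z Z z = 0.
  rewrite /Rintegral; under eq_integral do rewrite EFinB.
  rewrite integralB_EFin//; last exact: finite_measure_integrable_cst.
  by rewrite mE integral_cst//= probability_setT mule1 subee.
have Zp : (\int[P]_z (`|Z z| `^ p)%:E <= ((kappa * s2) `^ p)%:E)%E.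
  have <- : ('N[P]_(p%:E)[EFin \o Z] `^ p = \int[P]_z (`|Z z| `^ p)%:E)%E.
    by rewrite poweR_Lnorm ?gt_eqF.
  rewrite -poweR_EFin; apply: gt0_ler_poweR => //; first exact: ltW.
  - by rewrite in_itv /= Lnorm_ge0 leey.
  - by rewrite in_itv /= lee_fin leey andbT; nra.
have kE : kappa = kappa * s2 / s2 by rewrite mulfK ?gt_eqF.
rewrite {1}kE; apply: le_trans (fuk_nagaev_tail p2 s20 _ mZ iZ Z0 Zp).
  apply: le_measure; rewrite ?inE; [exact: measurable_emp_mean_gt..|].
  move=> w /=; suff -> : emp_mean xi Z w = emp_mean xi h w - m by lra.
  rewrite /emp_mean /Z sumrB sumr_const card_ord -[m *+ N]mulr_natl mulrBl.
  by rewrite mulrAC divff ?mul1r ?gt_eqF.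
by nra.
Qed.

End GreatIsGood.

(** * Generic chaining *)

Section Chaining.
Context {R : realType} {T : choiceType} (dst : T -> T -> R).
Implicit Types (M : set T) (A : nat -> set (set T)).

Lemma admissible_enum M A (j : nat) : admissible M A ->
  exists s : seq (set T), (size s <= 2 ^ (2 ^ j))%N /\
    forall c, A j c -> c \in s.
Proof.
move=> [_ A0 Aj].
have /pcard_surjP[g gs] : (A j #<= `I_(2 ^ (2 ^ j)))%card.
  case: j => [|j]; last exact: Aj.
  apply: (card_le_trans (B := `I_1)); last by rewrite card_le_II.
  by move: A0; rewrite card_eq_le => /andP[].
exists [seq g k | k <- iota 0 (2 ^ (2 ^ j))]; split.
  by rewrite size_map size_iota.
move=> c /gs [k /= kj <-]; apply: map_f.
by rewrite mem_iota.
Qed.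

Lemma dst_le_mesh A (j : nat) (c : set T) u v : A j c -> c u -> c v ->
  ((dst u v)%:E <= mesh dst (A j))%E.
Proof.
move=> Ac cu cv; apply: (@le_trans _ _ (diam dst c)).
  by apply: ereal_sup_ubound; exists u => //; exists v.
by apply: ereal_sup_ubound; exists c.
Qed.

(* The point of the chain at level j is chosen in the intersection of the cells
   of levels j and j+1, so that consecutive points share the cell of level j+1. *)
Lemma chaining_net M A : admissible M A ->
  exists (U : nat -> seq T) (V : nat -> seq (T * T)),
  [/\ forall j, (size (U j) <= 2 ^ (3 * 2 ^ j))%N,
      forall j, (size (V j) <= 2 ^ (7 * 2 ^ j))%N,
      forall j u, u \in U j -> M u,
      forall j p, p \in V j ->
        [/\ M p.1, M p.2 & ((dst p.1 p.2)%:E <= mesh dst (A j.+1))%E]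
    & forall x, M x -> exists y : nat -> T, forall j,
        [/\ y j \in U j, (y j, y j.+1) \in V j
          & ((dst x (y j))%:E <= mesh dst (A j))%E]].
Proof.
move=> adm; have [s s_] := choice (fun j => admissible_enum j adm).
have [x0|noM] := pselect (exists x0, M x0); last first.
  exists (fun=> [::]), (fun=> [::]); split => // x Mx.
  by exfalso; apply: noM; exists x.
case: x0 => x0 Mx0.
have sz j : (size (s j) <= 2 ^ (2 ^ j))%N by case: (s_ j).
(* For disjoint sets [rep] returns the default x0, and the enumerations may contain sets that are
   not cells. The filters below discard every point or link without the required properties and do
   not increase the counts. *)
pose rep (c c' : set T) : T := xget x0 (c `&` c').
(* A point is determined by cells of two consecutive levels and a link by cells of three; hence the
   exponents 1 + 2 = 3 and 1 + 2 + 4 = 7 in the size bounds. *)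
pose U0 j := [seq rep c c' | c <- s j, c' <- s j.+1].
pose V0 j := [seq (rep p.1 p.2, rep p.2 c) |
  p <- [seq (c, c') | c <- s j, c' <- s j.+1], c <- s j.+2].
exists (fun j => [seq u <- U0 j | `[< M u >]]).
exists (fun j => [seq p <- V0 j |
  `[< [/\ M p.1, M p.2 & ((dst p.1 p.2)%:E <= mesh dst (A j.+1))%E] >]]).
have e2 j : (2 ^ j.+1 = 2 * 2 ^ j)%N by rewrite expnS.
split.
- move=> j; rewrite size_filter; apply: leq_trans (count_size _ _) _.
  rewrite size_allpairs (_ : (3 * 2 ^ j = 2 ^ j + 2 ^ j.+1)%N); last by rewrite e2; ring.
  by rewrite expnD; apply: leq_mul; exact: sz.
- move=> j; rewrite size_filter; apply: leq_trans (count_size _ _) _.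
  rewrite !size_allpairs (_ : (7 * 2 ^ j = 2 ^ j + 2 ^ j.+1 + 2 ^ j.+2)%N); last first.
    by rewrite !e2; ring.
  rewrite expnD [X in (_ <= X * _)%N]expnD; apply: leq_mul; last exact: sz.
  by apply: leq_mul; exact: sz.
- by move=> j u; rewrite mem_filter => /andP[/asboolP].
- by move=> j p; rewrite mem_filter => /andP[/asboolP].
move=> x Mx; case: (adm) => part _ _.
have cellP j : exists c, A j c /\ c x.
  by case: (part j) => cov _ _; move: Mx; rewrite -cov => -[c Ac cx]; exists c.
have [cell cellx] := choice cellP.
have cellM j u : cell j u -> M u.
  by case: (part j) => <- _ _ cu; exists (cell j) => //; exact: (cellx j).1.
pose y j := rep (cell j) (cell j.+1).
have yP j : cell j (y j) /\ cell j.+1 (y j).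
  have : (cell j `&` cell j.+1) (y j).
    by apply: (xgetPex x0); exists x; split; exact: (cellx _).2.
  by case.
have cs j : cell j \in s j by apply: (s_ j).2; exact: (cellx j).1.
exists y => j; split.
- rewrite mem_filter; apply/andP; split.
    by apply/asboolP; exact: cellM (yP j).1.
  exact: allpairs_f.
- rewrite mem_filter; apply/andP; split.
    apply/asboolP; split; [exact: cellM (yP j).1|exact: cellM (yP j.+1).1|].
    exact: dst_le_mesh (cellx j.+1).1 (yP j).2 (yP j.+1).1.
  apply/allpairsP; exists ((cell j, cell j.+1), cell j.+2); split => //=.
  exact: allpairs_f.
exact: dst_le_mesh (cellx j).1 (cellx j).2 (yP j).1.
Qed.

Context (alpha : R) (M : set T).

Lemma gamma2_ge0 : (0 <= gamma2 alpha dst M)%E.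
Proof.
apply: le_ereal_inf_tmp => _ [A _ <-]; apply: nneseries_ge0 => j _ _.
by rewrite mule_ge0// ?poweR_ge0// lee_fin powR_ge0.
Qed.

Hypotheses (alpha_gt0 : 0 < alpha) (dst_ge0 : forall x y, 0 <= dst x y).
Hypothesis (diam_fin : (diam dst M < +oo)%E).
Hypothesis M_neq0 : M !=set0.

Lemma dst_le_diam u v : M u -> M v -> ((dst u v)%:E <= diam dst M)%E.
Proof. by move=> Mu Mv; apply: ereal_sup_ubound; exists u => //; exists v. Qed.

Lemma diam_ge0 : (0 <= diam dst M)%E.
Proof.
case: M_neq0 => x Mx; apply: le_trans (dst_le_diam Mx Mx).
by rewrite lee_fin.
Qed.

Lemma diam_fin_num : diam dst M \is a fin_num.
Proof. by rewrite ge0_fin_numE// diam_ge0. Qed.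

Lemma dst_powR_le_diam u v : M u -> M v ->
  dst u v `^ alpha <= fine (diam dst M `^ alpha)%E.
Proof.
move=> Mu Mv; rewrite fine_poweR ge0_ler_powR ?nnegrE ?(ltW alpha_gt0)//.
  by rewrite fine_ge0// diam_ge0.
by rewrite -lee_fin fineK ?diam_fin_num// dst_le_diam.
Qed.

Lemma mesh_le_diam A (j : nat) : admissible M A ->
  (mesh dst (A j) <= diam dst M)%E.
Proof.
move=> [part _ _]; apply: ge_ereal_sup => _ [c Ac <-].
apply: ge_ereal_sup => _ [u cu [v cv <-]].
by apply: dst_le_diam; case: (part j) => <- _ _; exists c.
Qed.

Lemma mesh_ge0 A (j : nat) : admissible M A -> (0 <= mesh dst (A j))%E.
Proof.
move=> [part _ _]; case: M_neq0 => x Mx.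
have [c Ac cx] : exists2 c, A j c & c x.
  by case: (part j) => cov _ _; move: Mx; rewrite -cov => -[c Ac cx]; exists c.
by apply: le_trans (dst_le_mesh Ac cx cx); rewrite lee_fin.
Qed.

Lemma mesh0 A : admissible M A -> mesh dst (A 0%N) = diam dst M.
Proof.
move=> adm; apply/le_anti; rewrite mesh_le_diam//=.
case: adm => part A0 _; have [cov _ _] := part 0%N.
have /pcard_surjP[g gs] : (A 0%N #<= `I_1)%card.
  by move: A0; rewrite card_eq_le => /andP[].
have g0 c : A 0%N c -> c = g 0%N by move=> /gs[k /=]; rewrite ltnS leqn0 => /eqP ->.
apply: ereal_sup_ubound; exists M => //.
case: M_neq0 => x Mx.
have [c Ac cx] : exists2 c, A 0%N c & c x.
  by move: Mx; rewrite -cov => -[c Ac cx]; exists c.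
suff -> : M = c by [].
rewrite -cov; apply/seteqP; split=> [z [c' Ac' c'z]|z cz]; last by exists c.
by rewrite (g0 _ Ac) -(g0 _ Ac').
Qed.

Lemma mesh_fin_num A (j : nat) : admissible M A -> mesh dst (A j) \is a fin_num.
Proof.
move=> adm; rewrite ge0_fin_numE ?mesh_ge0//.
exact: le_lt_trans (mesh_le_diam j adm) diam_fin.
Qed.

Lemma dst_powR_le_mesh A (j : nat) u v : admissible M A ->
  ((dst u v)%:E <= mesh dst (A j))%E ->
  dst u v `^ alpha <= fine (mesh dst (A j) `^ alpha)%E.
Proof.
move=> adm uv; rewrite fine_poweR ge0_ler_powR ?nnegrE ?(ltW alpha_gt0)//.
  by rewrite fine_ge0// mesh_ge0.
by rewrite -lee_fin fineK ?mesh_fin_num.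
Qed.

(* The level-0 term of the chaining sum is diam(M)^alpha, exactly the slack lost
   when a nearly optimal admissible sequence replaces the infimum. *)
Lemma gamma2_near_opt : (gamma2 alpha dst M < +oo)%E ->
  (0 < diam dst M)%E ->
  exists A, admissible M A /\ forall n,
    \sum_(0 <= j < n) 2 `^ (j.+1%:R / 2) * fine (mesh dst (A j.+1) `^ alpha)%E
      <= fine (gamma2 alpha dst M).
Proof.
move=> g2fin diam0.
have g2num : gamma2 alpha dst M \is a fin_num by rewrite ge0_fin_numE ?gamma2_ge0.
have da0 : (0 < diam dst M `^ alpha)%E by rewrite poweR_gt0.
have danum : (diam dst M `^ alpha)%E \is a fin_num.
  by rewrite fin_num_poweR// diam_fin_num.
have : (gamma2 alpha dst M < gamma2 alpha dst M + diam dst M `^ alpha)%E.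
  by rewrite lteDl.
move=> /ereal_inf_lt[_ [A adm <-]] Alt; exists A; split => // n.
have term0 j : (0 <= (2 `^ (j%:R / 2))%:E * mesh dst (A j) `^ alpha)%E.
  by rewrite mule_ge0// ?poweR_ge0// lee_fin powR_ge0.
have := le_lt_trans (nneseries_lim_ge n.+1 (fun j _ _ => term0 j)) Alt.
rewrite big_nat_recl// mesh0// mul0r powRr0 mul1e addeC lteD2rE// => lt.
rewrite -lee_fin fineK// -sumEFin; apply: le_trans (ltW lt).
apply: lee_sum => j _; rewrite EFinM fineK//.
by rewrite fin_num_poweR// mesh_fin_num.
Qed.

(** All weights are at least 1, so if the meshes stayed above e from level m on, the partial sums
    would grow beyond g. This closes the chain: some level beyond any given one is as fine as
    desired. *)
Lemma mesh_powR_small A (g : R) : admissible M A ->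
  (forall n, \sum_(0 <= j < n) 2 `^ (j.+1%:R / 2) *
     fine (mesh dst (A j.+1) `^ alpha)%E <= g) ->
  forall (m : nat) (e : R), 0 < e ->
  exists n, (m <= n)%N /\ fine (mesh dst (A n) `^ alpha)%E < e.
Proof.
move=> adm sumg m e e0; apply: contrapT => no.
have big n : (m <= n)%N -> e <= fine (mesh dst (A n) `^ alpha)%E.
  by move=> mn; rewrite leNgt; apply/negP => lt; apply: no; exists n.
have b0 j : 0 <= fine (mesh dst (A j) `^ alpha)%E.
  by rewrite fine_ge0// poweR_ge0.
have b2 j : 1 <= 2 `^ (j.+1%:R / 2) :> R.
  by rewrite -[leLHS](powRr0 2) ler_powR// ?divr_ge0//; lra.
pose n := (Num.truncn (g / e)).+1.
have : n%:R * e <= g.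
  apply: le_trans (sumg (m + n)%N).
  rewrite (big_cat_nat _ (n := m)) ?leq_addr//=.
  apply: (@le_trans _ _ (\sum_(m <= j < m + n) e)).
    by rewrite sumr_const_nat addKn mulr_natl.
  rewrite -[leLHS]add0r lerD ?sumr_ge0//.
    by move=> j _; rewrite mulr_ge0 ?powR_ge0.
  apply: ler_sum_nat => j /andP[mj _].
  rewrite -[leLHS]mul1r; apply: ler_pM => //; [exact: ltW|apply: big; exact: leqW].
by rewrite -ler_pdivlMr// leNgt real_truncnS_gt ?num_real.
Qed.

End Chaining.

(** * Uniform deviation bounds along the chain *)

Lemma pow2_le_expR (R : realType) (n : nat) : (2 ^ n)%:R <= expR n%:R :> R.
Proof.
have e2 : 2 <= expR 1 :> R by apply: le_trans (expR_ge1Dx _); lra.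
have -> : expR n%:R = expR 1 ^+ n :> R by rewrite -expRM_natl mulr1.
by rewrite natrX lerXn2r ?nnegrE ?expR_ge0.
Qed.

Lemma exists_pow2 (R : realType) (s : R) : 1 <= s ->
  exists m, s <= (2 ^ m)%:R /\ (2 ^ m)%:R <= 2 * s.
Proof.
move=> s1; have ex : exists m, s <= (2 ^ m)%:R.
  exists (Num.truncn s).+1; apply: le_trans (ltW (real_truncnS_gt (num_real s))) _.
  by rewrite ler_nat ltnW// ltn_expl.
case: (ex_minnP ex) => -[|m] sm minm; first by exists 0%N; split => //; lra.
exists m.+1; split => //; rewrite expnS natrM ler_wpM2l//.
by rewrite leNgt; apply/negP => /ltW /minm; rewrite ltnn.
Qed.

(** Since 6 * 16 * 2^j = 16 * 3 * 2^(j+1), a link from level j to j+1 gets exactly the weight of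
    level j+1 in the chaining functional, times 4 sqrt 3. *)
Lemma sqrt_chaining_level (R : realType) (N j : nat) :
  Num.sqrt (6 * (16 * 2 ^+ j) / N%:R) =
  4 * Num.sqrt 3 * 2 `^ (j.+1%:R / 2) / Num.sqrt N%:R :> R.
Proof.
rewrite powRrM powR12_sqrt ?powR_ge0// powR_mulrn//.
rewrite -[RHS]ger0_norm; last by rewrite !mulr_ge0 ?invr_ge0 ?sqrtr_ge0.
rewrite -sqrtr_sqr; congr Num.sqrt.
by rewrite !exprMn exprVn !sqr_sqrtr ?exprn_ge0// (exprS _ j); ring.
Qed.

Section ChainingDeviations.
Context {R : realType} {dXi dOm : measure_display}.
Context {Xi : measurableType dXi} {Om : measurableType dOm}.
Context (P : probability Xi R) (Pr : probability Om R).
Context {N : nat} (xi : 'I_N -> {RV Pr >-> Xi}).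
Hypotheses (N_gt0 : (0 < N)%N) (xi_iid : iid_with_law P xi).

Lemma emp_meanB (f g : Xi -> R) w :
  emp_mean xi (fun z => f z - g z) w = emp_mean xi f w - emp_mean xi g w.
Proof. by rewrite /emp_mean sumrB mulrBl. Qed.

Lemma emp_meanZ (c : R) (f : Xi -> R) w :
  emp_mean xi (fun z => c * f z) w = c * emp_mean xi f w.
Proof. by rewrite /emp_mean -mulr_sumr mulrA. Qed.

Lemma ler_emp_mean (f g : Xi -> R) w : (forall z, f z <= g z) ->
  emp_mean xi f w <= emp_mean xi g w.
Proof. by move=> fg; rewrite ler_wpM2r ?invr_ge0// ler_sum. Qed.

Lemma emp_mean_cst (c : R) w : emp_mean xi (fun=> c) w = c.
Proof.
rewrite /emp_mean sumr_const card_ord -[c *+ N]mulr_natl mulrAC divff ?mul1r//.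
by rewrite pnatr_eq0 -lt0n.
Qed.

Lemma ler_norm_emp_mean (f : Xi -> R) w :
  `|emp_mean xi f w| <= emp_mean xi (fun z => `|f z|) w.
Proof.
rewrite /emp_mean normrM [X in _ * X]ger0_norm ?invr_ge0//.
by rewrite ler_wpM2r ?invr_ge0// ler_norm_sum.
Qed.

Lemma emp_meanD (f g : Xi -> R) w :
  emp_mean xi (fun z => f z + g z) w = emp_mean xi f w + emp_mean xi g w.
Proof. by rewrite /emp_mean big_split/= mulrDl. Qed.

Context {T : choiceType} (dst : T -> T -> R) (Y : set T) (sigma alpha : R).
Context (G : T -> Xi -> R) (L : Xi -> R).
Hypotheses (sigma_gt0 : 0 < sigma) (dst_ge0 : forall x y, 0 <= dst x y).
Hypothesis dst_sym : forall x y, dst x y = dst y x.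
Hypothesis mG : forall x, Y x -> measurable_fun setT (G x).
Hypothesis iG : forall x, Y x -> P.-integrable setT (EFin \o G x).
Hypothesis mL2 : measurable_fun setT (fun z => L z ^+ 2).
Hypothesis L2_le : (\int[P]_z (L z ^+ 2)%:E <= (sigma ^+ 2)%:E)%E.
Hypothesis G_hoelder : forall x x' z, Y x -> Y x' ->
  `|G x z - G x' z| <= L z * dst x x' `^ alpha.

Definition deviation (x : T) (w : Om) : R :=
  emp_mean xi (G x) w - \int[P]_z G x z.

(* Swapping u and v gives the other tail. The clause on squares holds automatically
   when the empirical mean of L^2 is at most 2 sigma^2. *)
Definition large_increment (u v : T) (b s : R) : set Om :=
  [set w | emp_mean xi (fun z => (G u z - G v z) ^+ 2) w <= 2 * (sigma * b) ^+ 2 /\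
    sigma * b * Num.sqrt (6 * s / N%:R) < deviation u w - deviation v w].

Lemma hoelder_sqr (u v : T) (b : R) z : Y u -> Y v -> dst u v `^ alpha <= b ->
  (G u z - G v z) ^+ 2 <= b ^+ 2 * L z ^+ 2.
Proof.
move=> Yu Yv uvb; have h := G_hoelder z Yu Yv.
have d0 : 0 <= dst u v `^ alpha by rewrite powR_ge0.
rewrite -[leLHS]real_normK ?num_real//.
apply: (@le_trans _ _ ((L z * dst u v `^ alpha) ^+ 2)).
  by rewrite lerXn2r ?nnegrE// (le_trans _ h).
rewrite exprMn mulrC ler_wpM2r ?sqr_ge0// lerXn2r ?nnegrE//.
exact: le_trans uvb.
Qed.

Lemma integral_increment_sqr (u v : T) (b : R) : Y u -> Y v ->
  dst u v `^ alpha <= b ->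
  (\int[P]_z ((G u z - G v z) ^+ 2)%:E <= ((sigma * b) ^+ 2)%:E)%E.
Proof.
move=> Yu Yv uvb.
apply: (@le_trans _ _ (\int[P]_z ((b ^+ 2)%:E * (L z ^+ 2)%:E))%E).
  apply: ge0_le_integral => //.
  - by move=> z _; rewrite lee_fin sqr_ge0.
  - apply/measurable_EFinP; apply: measurable_funX.
    by apply: measurable_funB; exact: mG.
  - by apply: measurable_funeM; exact/measurable_EFinP.
  by move=> z _; rewrite -EFinM lee_fin hoelder_sqr.
rewrite ge0_integralZl_EFin ?sqr_ge0//; last 2 first.
- by move=> z _; rewrite lee_fin sqr_ge0.
- exact/measurable_EFinP.
rewrite exprMn mulrC [leRHS]EFinM; apply: lee_wpmul2l => //.
by rewrite lee_fin sqr_ge0.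
Qed.

Lemma integrable_increment (u v : T) : Y u -> Y v ->
  P.-integrable setT (EFin \o (fun z => G u z - G v z)).
Proof.
move=> Yu Yv.
rewrite (_ : _ \o _ = (EFin \o G u) \- (EFin \o G v))%E//.
by apply: integrableB => //; exact: iG.
Qed.

Lemma deviationB (u v : T) w : Y u -> Y v -> deviation u w - deviation v w =
  emp_mean xi (fun z => G u z - G v z) w - \int[P]_z (G u z - G v z).
Proof.
move=> Yu Yv; rewrite emp_meanB RintegralB//; try exact: iG.
by rewrite /deviation; ring.
Qed.

Lemma measurable_large_increment (u v : T) (b s : R) : Y u -> Y v ->
  measurable (large_increment u v b s).
Proof.
move=> Yu Yv; apply: measurableI.
  apply: measurable_emp_mean_le; apply: measurable_funX.
  by apply: measurable_funB; exact: mG.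
apply: measurable_set_lt => //; apply: measurable_funB; apply: measurable_funB => //;
  by apply: measurable_emp_mean; exact: mG.
Qed.

Lemma pr_large_increment (u v : T) (b s : R) : Y u -> Y v ->
  dst u v `^ alpha <= b -> 0 <= s ->
  (Pr (large_increment u v b s) <= (expR (- s))%:E)%E.
Proof.
move=> Yu Yv uvb s0.
have b0 : 0 <= b by apply: le_trans uvb; exact: powR_ge0.
(* The tail bound asks for a positive variance proxy. For b = 0 the increment vanishes identically,
   and the strict inequality makes the event empty. *)
have [b_gt0|b_le0] := ltP 0 b; last first.
  have bE : b = 0 by apply/le_anti; rewrite b0 b_le0.
  rewrite (_ : large_increment _ _ _ _ = set0) ?measure0 ?lee_fin ?expR_ge0//.
  have D0 : (fun z => G u z - G v z) = (fun=> 0).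
    apply/funext => z; apply/eqP; rewrite -sqrf_eq0 eq_le sqr_ge0 andbT.
    by have := hoelder_sqr z Yu Yv uvb; rewrite bE expr0n mul0r.
  apply/seteqP; split => // w [_]; rewrite deviationB// D0 emp_mean_cst.
  by rewrite /Rintegral integral0 /= bE mulr0 mul0r subrr ltxx.
have v0 : 0 < (sigma * b) ^+ 2 by rewrite exprn_gt0// mulr_gt0.
rewrite (_ : large_increment _ _ _ _ = [set w |
    (emp_mean xi (fun z => (G u z - G v z) ^+ 2) w <= 2 * (sigma * b) ^+ 2) /\
    (Num.sqrt (6 * (sigma * b) ^+ 2 * s / N%:R) <
       emp_mean xi (fun z => G u z - G v z) w - \int[P]_z (G u z - G v z))]).
  apply: (self_normalized_tail xi_iid N_gt0) => //.
  - by apply: measurable_funB; exact: mG.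
  - exact: integrable_increment.
  - exact: integral_increment_sqr.
have -> : Num.sqrt (6 * (sigma * b) ^+ 2 * s / N%:R) = sigma * b * Num.sqrt (6 * s / N%:R).
  rewrite -{2}[sigma * b]gtr0_norm ?mulr_gt0// -sqrtr_sqr -sqrtrM ?sqr_ge0//.
  by congr Num.sqrt; ring.
by apply/seteqP; split => w; rewrite /large_increment /= deviationB.
Qed.

Lemma increment_le (u v : T) (b s : R) w : Y u -> Y v -> dst u v `^ alpha <= b ->
  emp_mean xi (fun z => L z ^+ 2) w <= 2 * sigma ^+ 2 ->
  ~ large_increment u v b s w ->
  deviation u w - deviation v w <= sigma * b * Num.sqrt (6 * s / N%:R).
Proof.
move=> Yu Yv uvb Lw nw; rewrite leNgt; apply/negP => lt; apply: nw; split => //.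
apply: (@le_trans _ _ (emp_mean xi (fun z => b ^+ 2 * L z ^+ 2) w)).
  by apply: ler_emp_mean => z; exact: hoelder_sqr.
by rewrite emp_meanZ exprMn; have := sqr_ge0 b; nra.
Qed.

(** A crude modulus of continuity, used only for the last piece between a point and its chain, where
    b can be made arbitrarily small. The constant is (1 + 2 sigma^2) + (1 + sigma^2), from the
    empirical mean and the expectation. *)
Lemma deviation_continuous (u v : T) (b : R) w : Y u -> Y v -> dst u v `^ alpha <= b ->
  emp_mean xi (fun z => L z ^+ 2) w <= 2 * sigma ^+ 2 ->
  `|deviation u w - deviation v w| <= (2 + 3 * sigma ^+ 2) * b.
Proof.
move=> Yu Yv uvb Lw.
have b0 : 0 <= b by apply: le_trans uvb; exact: powR_ge0.
(* The majorant involves [L ^+ 2] and not [L], because measurability and moments are assumed for the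
   square only. *)
have D_le z : `|G u z - G v z| <= b * (1 + L z ^+ 2).
  have h2 := hoelder_sqr z Yu Yv uvb; have L20 := sqr_ge0 (L z).
  rewrite -(@ler_pXn2r _ 2) ?nnegrE//; last by rewrite mulr_ge0// addr_ge0.
  rewrite real_normK ?num_real// exprMn; apply: le_trans h2 _.
  by rewrite ler_wpM2l ?sqr_ge0//; nra.
have emp_le : `|emp_mean xi (fun z => G u z - G v z) w| <= b * (1 + 2 * sigma ^+ 2).
  apply: le_trans (ler_norm_emp_mean _ _) _.
  apply: le_trans (ler_emp_mean _ D_le) _.
  by rewrite emp_meanZ emp_meanD emp_mean_cst ler_wpM2l// lerD2l.
have int_le : `|\int[P]_z (G u z - G v z)| <= b * (1 + sigma ^+ 2).
  have iD := integrable_increment Yu Yv.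
  rewrite -lee_fin EFin_normr_Rintegral//.
  apply: le_trans (le_abse_integral _ _ _) _ => //.
    exact: measurable_int iD.
  apply: (@le_trans _ _ (\int[P]_z (b%:E * (1%:E + (L z ^+ 2)%:E)))%E).
    apply: ge0_le_integral => //.
    - by apply: measurableT_comp => //; exact: measurable_int iD.
    - apply: measurable_funeM; apply: emeasurable_funD => //; exact/measurable_EFinP.
    by move=> z _; rewrite -EFinD -EFinM abse_EFin lee_fin.
  have mL1 : measurable_fun [set: Xi] (fun z => (1%:E + (L z ^+ 2)%:E)%E).
    by apply: emeasurable_funD => //; exact/measurable_EFinP.
  rewrite ge0_integralZl_EFin//; last first.
    by move=> z _; rewrite -EFinD lee_fin addr_ge0// sqr_ge0.
  rewrite [leRHS]EFinM; apply: lee_wpmul2l => //.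
  rewrite ge0_integralD//; last 2 first.
  - by move=> z _; rewrite lee_fin sqr_ge0.
  - exact/measurable_EFinP.
  by rewrite integral_cst//= probability_setT mule1 EFinD leeD2l.
rewrite deviationB//; apply: le_trans (ler_normB _ _) _.
by apply: le_trans (lerD emp_le int_le) _; rewrite -mulrDr mulrC; nra.
Qed.

(** Chaining with the nets as data: [b j] stands for the mesh of level j to the power alpha, and
    [Dm] for the diameter to that power. The budget 2 e^(-s) is split evenly between the jump from
    x0 to level m and all later links. *)
Lemma chaining_deviation (x0 : T) (Dm : R) (b : nat -> R) (g s : R)
    (U : nat -> seq T) (V : nat -> seq (T * T)) :
  Y x0 -> 1 <= s -> (forall j, 0 <= b j) ->
  (forall u v, Y u -> Y v -> dst u v `^ alpha <= Dm) ->
  (forall j, (size (U j) <= 2 ^ (3 * 2 ^ j))%N) ->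
  (forall j, (size (V j) <= 2 ^ (7 * 2 ^ j))%N) ->
  (forall j u, u \in U j -> Y u) ->
  (forall j p, p \in V j ->
     [/\ Y p.1, Y p.2 & dst p.1 p.2 `^ alpha <= b j.+1]) ->
  (forall x, Y x -> exists y : nat -> T, forall j,
     [/\ y j \in U j, (y j, y j.+1) \in V j & dst x (y j) `^ alpha <= b j]) ->
  (forall n, \sum_(0 <= j < n) 2 `^ (j.+1%:R / 2) * b j.+1 <= g) ->
  (forall m e, 0 < e -> exists n, (m <= n)%N /\ b n < e) ->
  exists E : set Om, [/\ measurable E, (Pr E <= (2 * expR (- s))%:E)%E
    & forall w, ~ E w -> emp_mean xi (fun z => L z ^+ 2) w <= 2 * sigma ^+ 2 ->
      forall x, Y x -> `|deviation x w - deviation x0 w| <=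
        sigma / Num.sqrt N%:R *
          (4 * Num.sqrt 3 * g + 6 * Num.sqrt 3 * Num.sqrt s * Dm)].
Proof.
move=> Yx0 s1 b0 YDm sizeU sizeV UY VY path sumg small.
have [m [sm ms]] := exists_pow2 s1.
have n0 : 0 < N%:R :> R by rewrite ltr0n.
pose inc u v c r := large_increment u v c r `|` large_increment v u c r.
have minc u v c r : Y u -> Y v -> measurable (inc u v c r).
  by move=> Yu Yv; apply: measurableU; exact: measurable_large_increment.
have pinc u v c r : Y u -> Y v -> dst u v `^ alpha <= c -> 0 <= r ->
    (Pr (inc u v c r) <= (2 * expR (- r))%:E)%E.
  move=> Yu Yv uvc r0; apply: le_trans (measureU2 _ _ _) _.
  - exact: measurable_large_increment.
  - exact: measurable_large_increment.
  rewrite (_ : 2 * _ = expR (- r) + expR (- r)); last by ring.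
  by rewrite EFinD; apply: leeD; apply: pr_large_increment => //; rewrite dst_sym.
have inc_le u v c r w : Y u -> Y v -> dst u v `^ alpha <= c ->
    emp_mean xi (fun z => L z ^+ 2) w <= 2 * sigma ^+ 2 -> ~ inc u v c r w ->
    `|deviation u w - deviation v w| <= sigma * c * Num.sqrt (6 * r / N%:R).
  move=> Yu Yv uvc Lw /not_orP[n1 n2]; rewrite ler_norml lerNl opprB.
  apply/andP; split; last exact: increment_le n1.
  by apply: increment_le n2 => //; rewrite dst_sym.
pose EU : set Om := \big[setU/set0]_(u <- U m) inc u x0 Dm (18 * s).
pose EV k : set Om := \big[setU/set0]_(p <- V (m + k)%N)
   inc p.1 p.2 (b (m + k).+1) (16 * 2 ^+ (m + k)).
have [mEU pEU] : measurable EU /\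
    (Pr EU <= ((size (U m))%:R * (2 * expR (- (18 * s))))%:E)%E.
  apply: measure_bigsetU_le => u uU; have Yu := UY _ _ uU; split; first exact: minc.
  by apply: pinc => //; [exact: YDm|lra].
have EVP k : measurable (EV k) /\
    (Pr (EV k) <= ((size (V (m + k)%N))%:R * (2 * expR (- (16 * 2 ^+ (m + k)))))%:E)%E.
  apply: measure_bigsetU_le => p pV; have [Y1 Y2 p12] := VY _ _ pV.
  split; first exact: minc.
  by apply: pinc => //; rewrite mulr_ge0 ?exprn_ge0.
exists (EU `|` \bigcup_k EV k); split.
- by apply: measurableU => //; apply: bigcupT_measurable => k; exact: (EVP k).1.
- apply: le_trans (measureU2 _ mEU _) _.
    by apply: bigcupT_measurable => k; exact: (EVP k).1.
  rewrite (_ : 2 * expR _ = expR (- s) + expR (- s)); last by ring.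
  rewrite EFinD; apply: leeD.
    apply: le_trans pEU _; rewrite lee_fin.
    (* As 2^m <= 2 s, the net has at most e^(6 s) points, and 6 s + 1 - 18 s <= - s. The confidence
       18 s gives 6 * 18 = 36 * 3, that is, the factor 6 sqrt 3. *)
    apply: (@le_trans _ _ (expR (3 * 2 ^+ m) * (expR 1 * expR (- (18 * s))))).
      rewrite ler_pM ?mulr_ge0 ?expR_ge0//.
        apply: (@le_trans _ _ (2 ^ (3 * 2 ^ m))%:R); first by rewrite ler_nat.
        by have := pow2_le_expR R (3 * 2 ^ m); rewrite natrM (natrX _ 2 m).
      by rewrite ler_wpM2r ?expR_ge0//; exact: (pow2_le_expR R 1).
    by rewrite -!expRD ler_expR -natrX; lra.
  apply: (@le_trans _ _ (\sum_(k <oo) Pr (EV k))%E).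
    apply: measure_sigma_subadditive => // [k|]; first exact: (EVP k).1.
    by apply: bigcupT_measurable => k; exact: (EVP k).1.
  (* Level m + k gets the share e^(-s) / 2^(k+1): since 2^m >= s and 2^k >= k + 1, the surplus (16 -
     7) 2^(m+k) covers s + k + 2. *)
  apply: le_trans (epsilon_trick0 xpredT (expR_ge0 (- s))).
  apply: lee_nneseries => // k _; apply: le_trans (EVP k).2 _; rewrite lee_fin.
  rewrite ler_pdivlMr; last by rewrite ltr0n expn_gt0.
  apply: (@le_trans _ _ (expR (7 * 2 ^+ (m + k)) *
      (expR 1 * expR (- (16 * 2 ^+ (m + k)))) * expR k.+1%:R)).
    apply: ler_pM; rewrite ?mulr_ge0 ?expR_ge0//; last exact: pow2_le_expR.
    apply: ler_pM; rewrite ?mulr_ge0 ?expR_ge0//.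
      apply: (@le_trans _ _ (2 ^ (7 * 2 ^ (m + k)))%:R); first by rewrite ler_nat.
      by have := pow2_le_expR R (7 * 2 ^ (m + k)); rewrite natrM (natrX _ 2 (m + k)).
    by rewrite ler_wpM2r ?expR_ge0//; exact: (pow2_le_expR R 1).
  rewrite -!expRD ler_expR -natrX expnD natrM.
  have k2 : k.+1%:R <= (2 ^ k)%:R :> R by rewrite ler_nat ltn_expl.
  have k1 : 1 <= k.+1%:R :> R by rewrite ler1n.
  nra.
move=> w /not_orP[nU nV] Lw x Yx; have [y yP] := path x Yx.
have Yy j : Y (y j) by have [yU _ _] := yP j; exact: UY yU.
set C := sigma / Num.sqrt N%:R.
have C0 : 0 <= C by rewrite divr_ge0 ?sqrtr_ge0// ltW.
(* The links of levels m to n are bounded by the partial sum from level 0, whose additional terms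
   are nonnegative, so that [sumg] applies as it stands. *)
have g1 n : (m <= n)%N -> `|deviation (y n) w - deviation (y m) w| <=
    C * (4 * Num.sqrt 3) * \sum_(0 <= j < n) 2 `^ (j.+1%:R / 2) * b j.+1.
  have Cj j : (m <= j)%N -> `|deviation (y j.+1) w - deviation (y j) w| <=
      C * (4 * Num.sqrt 3) * (2 `^ (j.+1%:R / 2) * b j.+1).
    move=> mj; rewrite distrC; have [_ yV _] := yP j.
    have [_ _ yb] := VY _ _ yV.
    rewrite (_ : C * _ * _ = sigma * b j.+1 * Num.sqrt (6 * (16 * 2 ^+ j) / N%:R)).
      apply: (inc_le _ _ _ _ _ (Yy j) (Yy j.+1) yb Lw) => inc_w; apply: nV.
      exists (j - m)%N => //; rewrite /EV subnKC// -bigcup_seq.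
      by exists (y j, y j.+1).
    by rewrite sqrt_chaining_level /C; ring.
  have S0 j : 0 <= 2 `^ (j.+1%:R / 2) * b j.+1 by rewrite mulr_ge0// powR_ge0.
  elim: n => [|n IH] mn.
    by move: mn; rewrite leqn0 => /eqP ->; rewrite subrr normr0 big_nil mulr0.
  have [->|mn'] := eqVneq m n.+1.
    rewrite subrr normr0 mulr_ge0 ?sumr_ge0// mulr_ge0// mulr_ge0// sqrtr_ge0.
  have {}mn : (m <= n)%N by lia.
  rewrite big_nat_recr//= mulrDr [leRHS]addrC.
  have -> : deviation (y n.+1) w - deviation (y m) w =
    (deviation (y n.+1) w - deviation (y n) w) + (deviation (y n) w - deviation (y m) w) by ring.
  by apply: le_trans (ler_normD _ _) _; apply: lerD; [exact: Cj|exact: IH].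
have g2 : `|deviation (y m) w - deviation x0 w| <=
    C * (6 * Num.sqrt 3 * Num.sqrt s * Dm).
  have [yU _ _] := yP m.
  rewrite (_ : C * _ = sigma * Dm * Num.sqrt (6 * (18 * s) / N%:R)).
    apply: inc_le => //; first exact: YDm.
    by move=> inc_w; apply: nU; rewrite /EU -bigcup_seq; exists (y m).
  have -> : Num.sqrt (6 * (18 * s) / N%:R) =
      6 * Num.sqrt 3 * Num.sqrt s / Num.sqrt N%:R.
    rewrite -[RHS]ger0_norm; last by rewrite !mulr_ge0 ?invr_ge0 ?sqrtr_ge0.
    rewrite -sqrtr_sqr; congr Num.sqrt.
    by rewrite !exprMn exprVn !sqr_sqrtr//; [field; rewrite gt_eqF|lra].
  by rewrite /C; ring.
(* The chain is stopped at a level n where the distance left to x contributes at most e; no limit of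
   the chain is taken. *)
apply/ler_addgt0Pr => e e0.
have c0 : 0 < 2 + 3 * sigma ^+ 2 by have := sqr_ge0 sigma; lra.
have [n [mn bn]] := small m (e / (2 + 3 * sigma ^+ 2)) (divr_gt0 e0 c0).
have g3 : `|deviation x w - deviation (y n) w| <= e.
  have [_ _ xy] := yP n.
  apply: le_trans (deviation_continuous Yx (Yy n) xy Lw) _.
  by move: bn; rewrite ltr_pdivlMr// mulrC => /ltW.
have g4 : C * (4 * Num.sqrt 3) * (\sum_(0 <= j < n) 2 `^ (j.+1%:R / 2) * b j.+1)
    <= C * (4 * Num.sqrt 3 * g).
  by rewrite -mulrA ler_wpM2l// ler_wpM2l// mulr_ge0// sqrtr_ge0.
have -> : deviation x w - deviation x0 w = (deviation x w - deviation (y n) w) +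
    ((deviation (y n) w - deviation (y m) w) + (deviation (y m) w - deviation x0 w)).
  by ring.
apply: le_trans (ler_normD _ _) _; rewrite [leRHS]addrC; apply: lerD => //.
apply: le_trans (ler_normD _ _) _; rewrite mulrDr; apply: lerD => //.
exact: le_trans (g1 n mn) g4.
Qed.

End ChainingDeviations.

Lemma optval_minimizer (R : realType) (T : Type) (g : T -> R) (A : set T) x :
  is_minimizer g A x -> optval g A = (g x)%:E.
Proof.
move=> [Ax gmin]; apply/le_anti/andP; split.
  by apply: ereal_inf_lbound; exists x.
by apply: le_ereal_inf_tmp => _ [y Ay <-]; rewrite lee_fin gmin.
Qed.

(** * Consequences of small deviations for the programs *)

Section Deterministic.
Context {R : realType} {d : nat} {I : finType}.
Context (Y : set 'rV[R]_d) (f g : option I -> 'rV[R]_d -> R).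
Context (xstar xhat : 'rV[R]_d) (r pw eps0 : R).
Hypotheses (r_ge0 : 0 <= r) (pw_ge0 : 0 <= pw).
Hypothesis xstar_min : is_minimizer (f None) (feasible Y f 0%E) xstar.
Hypothesis xhat_min : is_minimizer (g None) (feasible Y g 0%E) xhat.
Hypothesis dev_le : forall i x, Y x ->
  `|(g i x - f i x) - (g i xstar - f i xstar)| <= r.
Hypothesis dev_xstar : forall i, `|g i xstar - f i xstar| <= pw.

Let delta : R := if #|I| == 0%N then 0 else pw + r.

Let delta_ge0 : 0 <= delta.
Proof. by rewrite /delta; case: ifP => // _; rewrite addr_ge0. Qed.

Let deltaE (i : I) : delta = pw + r.
Proof.
rewrite /delta ifF//; apply/negbTE; rewrite -lt0n.
by apply/card_gt0P; exists i.
Qed.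

Let dev_bound i x : Y x -> `|g i x - f i x| <= pw + r.
Proof.
move=> Yx; have := dev_le i Yx; have := dev_xstar i.
by rewrite !ler_norml => /andP[? ?] /andP[? ?]; apply/andP; split; lra.
Qed.

Let fin_dev (i : I) x : Y x -> `|g (Some i) x - f (Some i) x| <= delta.
Proof. by move=> Yx; rewrite (deltaE i) dev_bound. Qed.

Lemma saa_feasible : feasible Y g 0%E `<=` feasible Y f delta%:E.
Proof.
move=> x [Yx gx]; split => // i; have := gx i; have := fin_dev i Yx.
by rewrite ler_norml !lee_fin => /andP[? ?] ?; lra.
Qed.

(** The point [xstar] may be infeasible for the SAA. Points of the tightened problem are feasible
    for it and serve as competitors instead, which is how the gap at - delta enters. *)
Lemma tightened_saa_feasible : feasible Y f (- delta%:E) `<=` feasible Y g 0%E.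
Proof.
move=> x [Yx fx]; split => // i; have := fx i; have := fin_dev i Yx.
by rewrite -EFinN ler_norml !lee_fin => /andP[? ?] ?; lra.
Qed.

Lemma le_tightened_optimum :
  ((f None xstar)%:E <= optimum Y f (- delta%:E))%E.
Proof.
apply: le_ereal_inf_tmp => _ [y [Yy fy] <-]; rewrite lee_fin.
apply: xstar_min.2; split => // i; have := fy i.
by rewrite -EFinN !lee_fin; have := delta_ge0; lra.
Qed.

(** A near-optimal x is compared with each y of the tightened problem. In the difference of their
    deviations the deviation at [xstar] cancels, so this costs 2 r and not 2 (pw + r), and f(x) <=
    f(y) + eps0 + 2 r. If there is no such y, the gap is infinite. *)
Lemma saa_near_opt :
  near_opt (g None) (feasible Y g 0%E) (optimum Y g 0%E) eps0%:E `<=`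
  near_opt (f None) (feasible Y f delta%:E) (optimum Y f 0%E)
    (eps0%:E + 2%:E * r%:E + gap Y f (- delta%:E)).
Proof.
move=> x [xX +]; rewrite /gap /optimum (optval_minimizer xstar_min) (optval_minimizer xhat_min).
rewrite -EFinD lee_fin => gx; split; first exact: saa_feasible.
have Yx : Y x by case: xX.
have := le_tightened_optimum.
have : ((f None x - eps0 - 2 * r)%:E <= optimum Y f (- delta%:E))%E.
  apply: le_ereal_inf_tmp => _ [y fy <-]; rewrite lee_fin.
  have Yy : Y y by case: fy.
  have := xhat_min.2 _ (tightened_saa_feasible fy).
  have := dev_le None Yx; have := dev_le None Yy.
  by rewrite !ler_norml => /andP[? ?] /andP[? ?]; lra.
rewrite /optimum; case: (optval _ _) => [v| |] //=.
- rewrite !lee_fin => h1 h2.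
  by have := ler_norm (v - f None xstar); lra.
- by move=> _ _; rewrite !addey// leey.
Qed.

(** The SAA value is at most f(y) + pw + r for every y of the tightened problem, and it is at least
    f(xhat) - pw - r, where xhat lies in the relaxed feasible set. With constraints, pw + r is
    delta. Without constraints only pw is paid in front, and the r is covered by the term 2 r of the
    maximum. *)
Lemma saa_optimum_dev :
  (`| optimum Y g 0%E - optimum Y f 0%E | <=
     (if #|I| == 0%N then pw else 0)%:E + delta%:E +
     maxe (2%:E * r%:E + gap Y f (- delta%:E)) (gap Y f delta%:E))%E.
Proof.
have r0 := r_ge0; have pw0 := pw_ge0.
have Yxhat : Y xhat by case: xhat_min => -[].
set o1 := optimum Y f (- delta%:E)%E; set o2 := optimum Y f delta%:E.
have gE : optimum Y g 0%E = (g None xhat)%:E by exact: optval_minimizer.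
have fE : optimum Y f 0%E = (f None xstar)%:E by exact: optval_minimizer.
set fs := f None xstar in fE; set gs := g None xhat in gE.
set od : R := if _ then pw else 0.
have o1_fs : (fs%:E <= o1)%E by exact: le_tightened_optimum.
have o1_gs : ((gs - pw - r)%:E <= o1)%E.
  apply: le_ereal_inf_tmp => _ [y fy <-]; rewrite lee_fin.
  have Yy : Y y by case: fy.
  have := xhat_min.2 _ (tightened_saa_feasible fy).
  by have := dev_bound None Yy; rewrite ler_norml /gs => /andP[? ?]; lra.
have fxhat : f None xhat <= gs + pw + r.
  by have := dev_bound None Yxhat; rewrite ler_norml /gs => /andP[? ?]; lra.
have o2_gs : (o2 <= (gs + pw + r)%:E)%E.
  apply: (@le_trans _ _ (f None xhat)%:E); last by rewrite lee_fin.
  by apply: ereal_inf_lbound; exists xhat => //; exact: saa_feasible xhat_min.1.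
have up : ((gs - fs - od - delta)%:E <= 2%:E * r%:E + `|o1 - fs%:E|)%E.
  move: o1_fs o1_gs; case: o1 => [v| |] //=.
  - rewrite !lee_fin => h1 h2.
    have := ler_norm (v - fs); rewrite /od /delta.
    by case: ifP => _; lra.
  - by move=> _ _; rewrite addey// leey.
have down : ((fs - gs - od - delta)%:E <=
    maxe (2%:E * r%:E + `|o1 - fs%:E|) (`|o2 - fs%:E|))%E.
  rewrite le_max; apply/orP; have [I0|I0] := eqVneq #|I| 0%N.
    left; apply: (@le_trans _ _ (2%:E * r%:E)%E); last by rewrite leeDl.
    have : fs <= f None xhat.
      apply: xstar_min.2; split => // i; exfalso.
      have : (0 < #|I|)%N by apply/card_gt0P; exists i.
      by rewrite I0.
    by rewrite -EFinM lee_fin /od /delta I0 eqxx; lra.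
  right; move: o2_gs; case: o2 => [v| |] //=; last by rewrite leey.
  rewrite !lee_fin => h1.
  have := ler_norm (- (v - fs)); rewrite normrN /od /delta (negbTE I0).
  by lra.
have {}up : ((gs - fs - od - delta)%:E <=
    maxe (2%:E * r%:E + `|o1 - fs%:E|) (`|o2 - fs%:E|))%E.
  by rewrite le_max up.
rewrite /gap -/o1 -/o2 gE fE.
move: up down; case: (maxe _ _) => [v| |] //=; last by move=> _ _; rewrite addey// leey.
rewrite !lee_fin => h1 h2; rewrite ler_norml.
by apply/andP; split; lra.
Qed.

End Deterministic.

Section DeterministicGood.
Context {R : realType} {dXi dOm : measure_display}.
Context {Xi : measurableType dXi} {Om : measurableType dOm}.
Context (P : probability Xi R) (Pr : probability Om R).
Context {N : nat} (xi : 'I_N -> {RV Pr >-> Xi}).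
Context {d : nat} (nrm : 'rV[R]_d -> R) (Y : set 'rV[R]_d).
Context {I : finType} (F : option I -> 'rV[R]_d -> Xi -> R).
Context (xstar : 'rV[R]_d) (sigmastar sigma alpha eps0 t : R) (w : Om).
Hypothesis xstar_min :
  is_minimizer (mean_fun P F None) (feasible Y (mean_fun P F) 0%E) xstar.
Hypothesis saa_min : exists x,
  is_minimizer (saa_fun xi F w None) (feasible Y (saa_fun xi F w) 0%E) x.
Hypothesis sigmastar_ge0 : 0 <= sigmastar.

Lemma pointwise_dev_ge0 : 0 <= pointwise_dev (N := N) (I := I) sigmastar t.
Proof. by rewrite mulr_ge0// sqrtr_ge0. Qed.

Lemma Good_of_deviation (r : R) : 0 <= r ->
  r_hat nrm Y (N := N) (I := I) sigma alpha t = r%:E ->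
  (forall i x, Y x ->
     `|(saa_fun xi F w i x - mean_fun P F i x)
       - (saa_fun xi F w i xstar - mean_fun P F i xstar)| <= r) ->
  (forall i, `|saa_fun xi F w i xstar - mean_fun P F i xstar|
     <= pointwise_dev (N := N) (I := I) sigmastar t) ->
  Good P xi nrm Y F sigmastar sigma alpha eps0 t w.
Proof.
move=> r0 rE dev pw; have [xhat xhat_min] := saa_min.
have dE : delta_hat nrm Y (N := N) (I := I) sigmastar sigma alpha t =
    (if #|I| == 0%N then 0 else pointwise_dev (N := N) (I := I) sigmastar t + r)%:E.
  by rewrite /delta_hat rE; case: ifP.
rewrite /Good /= dE rE; split.
- exact: (saa_feasible dev pw).
- exact: (saa_near_opt r0 pointwise_dev_ge0 xstar_min xhat_min dev pw).
- exact: (saa_optimum_dev r0 pointwise_dev_ge0 xstar_min xhat_min dev pw).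
Qed.

(** Infinite radii make the inequalities trivial, also without constraints, where [delta_hat] is 0
    but the radius still appears in both optimality bounds. *)
Lemma Good_of_infinite_r_hat :
  r_hat nrm Y (N := N) (I := I) sigma alpha t = +oo%E ->
  Good P xi nrm Y F sigmastar sigma alpha eps0 t w.
Proof.
move=> rE; have [xhat xhat_min] := saa_min.
have gE : optimum Y (saa_fun xi F w) 0%E = (saa_fun xi F w None xhat)%:E.
  exact: optval_minimizer.
have fE : optimum Y (mean_fun P F) 0%E = (mean_fun P F None xstar)%:E.
  exact: optval_minimizer.
have dXhat : feasible Y (saa_fun xi F w) 0%E `<=`
    feasible Y (mean_fun P F) (delta_hat nrm Y (N := N) (I := I) sigmastar sigma alpha t).
  move=> x [Yx _]; split => // i; rewrite /delta_hat rE ifF ?leey//.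
  by apply/negbTE; rewrite -lt0n; apply/card_gt0P; exists i.
have d0 : (0 <= delta_hat nrm Y (N := N) (I := I) sigmastar sigma alpha t)%E.
  by rewrite /delta_hat rE; case: ifP => // _; rewrite leey.
have r2 : (2%:E * +oo = +oo :> \bar R)%E by rewrite gt0_muley// lte_fin.
(* The sum of +oo and -oo is -oo in these extended reals, so each other summand must be kept away
   from -oo. *)
have gap0 (e : \bar R) : (gap Y (mean_fun P F) e != -oo)%E.
  by rewrite gt_eqF// (lt_le_trans (ltNyr 0)) ?abse_ge0.
rewrite /Good /= rE r2 gE fE; split => //.
  move=> x [xX _]; split; first exact: dXhat.
  by rewrite addey// addye// addey// leey.
rewrite addye//.
have maxE (e : \bar R) : maxe +oo%E e = +oo%E by apply/max_idPl; rewrite leey.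
rewrite maxE.
rewrite addey ?leey// gt_eqF// (@lt_le_trans _ _ 0%E)// adde_ge0// lee_fin.
by rewrite /objective_dev; case: ifP => // _; exact: pointwise_dev_ge0.
Qed.

End DeterministicGood.

(** * The exceptional event of a single index *)

Section IndexEvent.
Context {R : realType} {dXi dOm : measure_display}.
Context {Xi : measurableType dXi} {Om : measurableType dOm}.
Context (P : probability Xi R) (Pr : probability Om R).
Context {N : nat} (xi : 'I_N -> {RV Pr >-> Xi}).
Hypotheses (N_gt0 : (0 < N)%N) (xi_iid : iid_with_law P xi).
Context {T : choiceType} (dst : T -> T -> R) (Y : set T) (x0 : T).
Context (sigmastar sigma alpha rho s : R) (G : T -> Xi -> R) (L : Xi -> R).
Hypotheses (sigmastar_gt0 : 0 < sigmastar) (sigma_gt0 : 0 < sigma).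
Hypotheses (alpha_gt0 : 0 < alpha) (s_ge1 : 1 <= s).
Hypotheses (dst_ge0 : forall x y, 0 <= dst x y).
Hypothesis dst_sym : forall x y, dst x y = dst y x.
Hypothesis Yx0 : Y x0.
Hypothesis diam_fin : (diam dst Y < +oo)%E.
Hypothesis gamma2_fin : (gamma2 alpha dst Y < +oo)%E.
Hypothesis mG : forall x, Y x -> measurable_fun setT (G x).
Hypothesis iG : forall x, Y x -> P.-integrable setT (EFin \o G x).
Hypothesis x0_good :
  good_fun P xi (sigmastar ^+ 2) rho (fun z => (G x0 z - \int[P]_y G x0 y) ^+ 2).
Hypothesis L_good : good_fun P xi (sigma ^+ 2) rho (fun z => L z ^+ 2).
Hypothesis G_hoelder : forall x x' z, Y x -> Y x' ->
  `|G x z - G x' z| <= L z * dst x x' `^ alpha.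

Lemma gamma2_deviation :
  exists E : set Om, [/\ measurable E, (Pr E <= (2 * expR (- s))%:E)%E
    & forall w, ~ E w -> emp_mean xi (fun z => L z ^+ 2) w <= 2 * sigma ^+ 2 ->
      forall x, Y x -> `|deviation P xi G x w - deviation P xi G x0 w| <=
        sigma / Num.sqrt N%:R *
          (4 * Num.sqrt 3 * fine (gamma2 alpha dst Y) +
           6 * Num.sqrt 3 * Num.sqrt s * fine (diam dst Y `^ alpha)%E)].
Proof.
have Y0 : Y !=set0 by exists x0.
have [mL2 _ L2 _] := L_good.
(* A positive diameter provides the slack for an almost optimal admissible sequence. For diameter 0
   all points are at distance 0 from x0, and the deviations coincide outside the event excluded by
   the bound on [L ^+ 2]. *)
have [diam0|diam0] := ltP 0%E (diam dst Y).
  have [A [adm sumA]] := gamma2_near_opt dst_ge0 diam_fin Y0 gamma2_fin diam0.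
  have [U [V [sizeU sizeV UY VY path]]] := chaining_net dst adm.
  apply: (chaining_deviation N_gt0 xi_iid sigma_gt0 dst_sym mG iG mL2 L2 G_hoelder
    (b := fun j => fine (mesh dst (A j) `^ alpha)%E) (U := U) (V := V)) => //.
  - by move=> j; rewrite fine_ge0// poweR_ge0.
  - by move=> u v Yu Yv; exact: dst_powR_le_diam.
  - by move=> j p /VY[Y1 Y2 p12]; split => //; exact: (dst_powR_le_mesh (M := Y)).
  - move=> x /path[y yP]; exists y => j; have [yU yV xy] := yP j.
    by split => //; exact: (dst_powR_le_mesh (M := Y)).
  - by apply: (mesh_powR_small adm sumA).
exists set0; rewrite measure0; split => //.
move=> w _ Lw x Yx.
have d0 : dst x x0 = 0.
  apply/le_anti; rewrite dst_ge0 andbT -lee_fin; apply: le_trans diam0.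
  exact: dst_le_diam.
have dp : dst x x0 `^ alpha <= 0 by rewrite d0 powR0// gt_eqF.
apply: (@le_trans _ _ 0).
  rewrite -(mulr0 (2 + 3 * sigma ^+ 2)).
  exact: (deviation_continuous (dst := dst) N_gt0 iG mL2 L2 G_hoelder).
have g0 : 0 <= fine (gamma2 alpha dst Y) by rewrite fine_ge0// gamma2_ge0.
have dd0 : 0 <= fine (diam dst Y `^ alpha)%E by rewrite fine_ge0// poweR_ge0.
by rewrite mulr_ge0 ?addr_ge0 ?divr_ge0 ?mulr_ge0 ?sqrtr_ge0// ltW.
Qed.

(** The cost is 2 e^(-s) for the chain, e^(-s) for each of the two tails at x0, and [rho] for each
    of the two empirical second moments. *)
Lemma index_event :
  exists E : set Om, [/\ measurable E,
      (Pr E <= (4 * expR (- s) + 2 * rho)%:E)%E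
    & forall w, ~ E w ->
      (forall x, Y x -> `|deviation P xi G x w - deviation P xi G x0 w| <=
        sigma / Num.sqrt N%:R *
          (4 * Num.sqrt 3 * fine (gamma2 alpha dst Y) +
           6 * Num.sqrt 3 * Num.sqrt s * fine (diam dst Y `^ alpha)%E)) /\
      `|deviation P xi G x0 w| <= sigmastar * Num.sqrt (6 * s / N%:R)].
Proof.
have [E [mE pE devE]] := gamma2_deviation.
have [mL2 _ _ L2P] := L_good; have [mD2 _ D2 D2P] := x0_good.
have s0 : 0 <= s by have := s_ge1; lra.
set m := (\int[P]_y G x0 y)%R in mD2 D2 D2P.
have v0 : 0 < sigmastar ^+ 2 by rewrite exprn_gt0.
have sqrtE : Num.sqrt (6 * sigmastar ^+ 2 * s / N%:R) =
    sigmastar * Num.sqrt (6 * s / N%:R).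
  rewrite -[in RHS](gtr0_norm sigmastar_gt0) -sqrtr_sqr -sqrtrM ?sqr_ge0//.
  by congr Num.sqrt; ring.
pose B1 : set Om := [set w | 2 * sigma ^+ 2 < emp_mean xi (fun z => L z ^+ 2) w].
pose B2 : set Om := [set w | 2 * sigmastar ^+ 2 < emp_mean xi (fun z => (G x0 z - m) ^+ 2) w].
(* The values c = 1 and c = -1 give the two tails; both share the second moments of the centered
   variable. *)
pose B3 (c : R) : set Om := [set w |
  emp_mean xi (fun z => (c * (G x0 z - m)) ^+ 2) w <= 2 * sigmastar ^+ 2 /\
  sigmastar * Num.sqrt (6 * s / N%:R) <
     emp_mean xi (fun z => c * (G x0 z - m)) w - \int[P]_z (c * (G x0 z - m))].
have mDc c : measurable_fun setT (fun z => c * (G x0 z - m)).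
  by apply: measurable_funM => //; apply: measurable_funB => //; exact: mG.
have iD : P.-integrable setT (EFin \o (fun z => G x0 z - m)).
  rewrite (_ : _ \o _ = (EFin \o G x0) \- (EFin \o cst m))%E//.
  apply: integrableB => //; first exact: iG.
  exact: finite_measure_integrable_cst.
have iDc c : P.-integrable setT (EFin \o (fun z => c * (G x0 z - m))).
  rewrite (_ : _ \o _ = (fun z => c%:E * (G x0 z - m)%:E)%E); last first.
    by apply/funext => z /=; rewrite EFinM.
  exact: integrableZl.
have D0 c : (\int[P]_z (c * (G x0 z - m)) = 0)%R.
  rewrite RintegralZl// RintegralB//; [|exact: iG|exact: finite_measure_integrable_cst].
  by rewrite Rintegral_cst//= probability_setT /= mulr1 subrr mulr0.
have mB1 : measurable B1 by exact: measurable_emp_mean_gt.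
have mB2 : measurable B2 by exact: measurable_emp_mean_gt.
have mB3 c : measurable (B3 c).
  apply: measurableI; first by apply: measurable_emp_mean_le; exact: measurable_funX.
  apply: measurable_set_lt => //; apply: measurable_funB => //.
  exact: measurable_emp_mean.
have pB3 c : c ^+ 2 = 1 -> (Pr (B3 c) <= (expR (- s))%:E)%E.
  move=> c1; rewrite /B3 -sqrtE; apply: (self_normalized_tail xi_iid N_gt0) => //.
  apply: le_trans D2; rewrite le_eqVlt; apply/orP; left; apply/eqP; apply: eq_integral => z _.
  by rewrite exprMn c1 mul1r.
exists (E `|` (B1 `|` (B2 `|` (B3 1 `|` B3 (-1))))); split.
- by do 4 (apply: measurableU => //).
- have m3 := measurableU _ _ (mB3 1) (mB3 (-1)).
  have m2 := measurableU _ _ mB2 m3.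
  apply: le_trans (measureU2 _ mE (measurableU _ _ mB1 m2)) _.
  rewrite (_ : 4 * _ + _ =
    2 * expR (- s) + (rho + (rho + (expR (- s) + expR (- s))))); last by ring.
  rewrite EFinD; apply: leeD => //; rewrite EFinD.
  apply: le_trans (measureU2 _ mB1 m2) _; apply: leeD => //.
  rewrite EFinD; apply: le_trans (measureU2 _ mB2 m3) _; apply: leeD => //.
  rewrite EFinD; apply: le_trans (measureU2 _ (mB3 1) (mB3 (-1))) _.
  by apply: leeD; apply: pB3; rewrite ?sqrrN expr1n.
move=> w /not_orP[nE /not_orP[nB1 /not_orP[nB2 /not_orP[nB3 nB3']]]].
have Lw : emp_mean xi (fun z => L z ^+ 2) w <= 2 * sigma ^+ 2.
  by rewrite leNgt; apply/negP.
have Dw : emp_mean xi (fun z => (G x0 z - m) ^+ 2) w <= 2 * sigmastar ^+ 2.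
  by rewrite leNgt; apply/negP.
split; first exact: devE.
have one c : c ^+ 2 = 1 -> ~ B3 c w ->
    c * deviation P xi G x0 w <= sigmastar * Num.sqrt (6 * s / N%:R).
  move=> c1 nB; rewrite leNgt; apply/negP => lt; apply: nB; split.
    rewrite (_ : (fun z => (c * (G x0 z - m)) ^+ 2) = (fun z => (G x0 z - m) ^+ 2))//.
    by apply/funext => z; rewrite exprMn c1 mul1r.
  by rewrite D0 subr0 emp_meanZ emp_meanB emp_mean_cst.
have := one 1 (expr1n _ _) nB3; have := one (-1) _ nB3'.
rewrite sqrrN expr1n mulN1r mul1r => /(_ erefl) h1 h2.
by rewrite ler_norml lerNl h1 h2.
Qed.

End IndexEvent.

(** * Norm distances, radii and the probability of the good event *)

Section NormedDistance.
Context {R : realType} {d : nat} (nrm : 'rV[R]_d -> R).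
Hypothesis nrm_norm : is_norm nrm.

Lemma normdC x y : normd nrm x y = normd nrm y x.
Proof.
case: nrm_norm => _ nrmZ _.
by rewrite /normd -opprB -scaleN1r nrmZ normrN1 mul1r.
Qed.

Lemma nrm_ge0 x : 0 <= nrm x.
Proof.
case: nrm_norm => nrmD nrmZ _.
have := nrmD x (- x); rewrite subrr -scaleN1r nrmZ normrN1 mul1r.
by rewrite -(scale0r 0) nrmZ normr0 mul0r; lra.
Qed.

Lemma normd_ge0 x y : 0 <= normd nrm x y.
Proof. exact: nrm_ge0. Qed.

Lemma diam_normd_lty (Y : set 'rV[R]_d) (B : R) :
  (forall x, Y x -> nrm x <= B) -> (diam (normd nrm) Y < +oo)%E.
Proof.
move=> YB; apply: le_lt_trans (ltry (2 * B)).
apply: ge_ereal_sup => _ [x Yx [y Yy <-]]; rewrite lee_fin.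
case: nrm_norm => nrmD nrmZ _; apply: le_trans (nrmD _ _) _.
rewrite -scaleN1r nrmZ normrN1 mul1r.
by have := YB x Yx; have := YB y Yy; lra.
Qed.

End NormedDistance.

Section Radii.
Context {R : realType} {d : nat} (nrm : 'rV[R]_d -> R) (Y : set 'rV[R]_d).
Context {I : finType} {N : nat} (sigmastar sigma alpha t : R).
Hypotheses (sigmastar_gt0 : 0 < sigmastar) (sigma_gt0 : 0 < sigma).

Lemma log_term_ge1 : 0 <= t -> 1 <= log_term (I := I) t.
Proof.
move=> t0; rewrite /log_term.
have : 0 <= ln (2 * #|I|%:R + 2 : R).
  by apply: ln_ge0; have := ler0n R #|I|; lra.
by lra.
Qed.

(** The logarithm turns 4 (|I| + 1) into 4 (|I| + 1) / (2 |I| + 2) = 2, and the summand 1 of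
    [log_term] supplies the factor 1/e with 2/e <= 1. *)
Lemma expRN_log_term : (#|I|.+1%:R) * (4 * expR (- log_term (I := I) t)) <= expR (- t).
Proof.
have n0 := ler0n R #|I|.
have a0 : 0 < 2 * #|I|%:R + 2 :> R by lra.
rewrite /log_term -addrA !opprD expRD expRD [expR (- ln _)]expRN lnK ?posrE//.
rewrite -natr1 (_ : _ * _ = 2 * expR (- 1) * expR (- t)); last by field; rewrite gt_eqF.
rewrite -[leRHS]mul1r ler_wpM2r ?expR_ge0// expRN ler_pdivrMr ?expR_gt0// mul1r.
by apply: le_trans (expR_ge1Dx _); lra.
Qed.

Let r := r_hat nrm Y (I := I) (N := N) sigma alpha t.

Lemma r_hat_ge0 : (0 <= r)%E.
Proof.
rewrite /r /r_hat mule_ge0//.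
  by rewrite lee_fin divr_ge0 ?sqrtr_ge0// ltW.
by rewrite adde_ge0// mule_ge0 ?poweR_ge0 ?gamma2_ge0// lee_fin !mulr_ge0// sqrtr_ge0.
Qed.

Lemma delta_hat_ge0 :
  (0 <= delta_hat nrm Y (I := I) (N := N) sigmastar sigma alpha t)%E.
Proof.
rewrite /delta_hat; case: ifP => // _; rewrite adde_ge0 ?r_hat_ge0//.
by rewrite lee_fin pointwise_dev_ge0// ltW.
Qed.

Lemma r_hat_pinfty : (0 < N)%N ->
  gamma2 alpha (normd nrm) Y = +oo%E -> r = +oo%E.
Proof.
move=> N0 gE; rewrite /r /r_hat gE.
rewrite gt0_muley ?lte_fin ?mulr_gt0 ?sqrtr_gt0//.
rewrite addye ?gt0_muley ?lte_fin ?divr_gt0 ?sqrtr_gt0 ?ltr0n//.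
apply/negbT/gt_eqF/(lt_le_trans (ltNyr 0)); apply: mule_ge0; last exact: poweR_ge0.
by rewrite lee_fin !mulr_ge0// sqrtr_ge0.
Qed.

Lemma r_hat_fin : (gamma2 alpha (normd nrm) Y < +oo)%E ->
  diam (normd nrm) Y \is a fin_num ->
  r = (sigma / Num.sqrt N%:R *
    (4 * Num.sqrt 3 * fine (gamma2 alpha (normd nrm) Y) +
     6 * Num.sqrt 3 * Num.sqrt (log_term (I := I) t) *
       fine (diam (normd nrm) Y `^ alpha)%E))%:E.
Proof.
move=> gfin dfin.
have gnum : gamma2 alpha (normd nrm) Y \is a fin_num by rewrite ge0_fin_numE ?gamma2_ge0.
have dnum : (diam (normd nrm) Y `^ alpha)%E \is a fin_num by rewrite fin_num_poweR.
by rewrite /r /r_hat -[in LHS](fineK gnum) -[in LHS](fineK dnum).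
Qed.

End Radii.

Lemma sub_hoelder_over (R : realType) (dXi : measure_display)
    (Xi : measurableType dXi) (P : probability Xi R) (d : nat)
    (nrm : 'rV[R]_d -> R) (Y : set 'rV[R]_d) (I : finType)
    (F : option I -> 'rV[R]_d -> Xi -> R) (Q1 Q2 Q1' Q2' : (Xi -> R) -> Prop)
    (alpha : R) (xstar : 'rV[R]_d) (Z : set 'rV[R]_d) :
  (forall h, Q1 h -> Q1' h) -> (forall h, Q2 h -> Q2' h) ->
  hoelder_over P nrm Y F Q1 Q2 alpha xstar Z ->
  hoelder_over P nrm Y F Q1' Q2' alpha xstar Z.
Proof.
move=> Q1Q Q2Q [ZY cF xF LF]; split => // i; first exact: Q1Q.
by have [L [L2 FL]] := LF i; exists L; split => //; exact: Q2Q.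
Qed.

Section GoodProbability.
Context {R : realType} {d : nat} (nrm : 'rV[R]_d -> R) {I : finType}.
Context {dXi dOm : measure_display}.
Context {Xi : measurableType dXi} {Om : measurableType dOm}.
Context (P : probability Xi R) (Pr : probability Om R).
Context {N : nat} (xi : 'I_N -> {RV Pr >-> Xi}).
Context (Y : set 'rV[R]_d) (F : option I -> 'rV[R]_d -> Xi -> R).
Context (xstar : 'rV[R]_d) (sigmastar sigma alpha rho eps0 t : R).
Hypotheses (nrm_norm : is_norm nrm) (N_gt0 : (0 < N)%N).
Hypotheses (xi_iid : iid_with_law P xi) (F_car : caratheodory Y F).
Hypothesis F_int : forall i x, Y x -> P.-integrable setT (EFin \o F i x).
Hypothesis xstar_min :
  is_minimizer (mean_fun P F None) (feasible Y (mean_fun P F) 0%E) xstar.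
Hypothesis saa_min : forall w, exists x,
  is_minimizer (saa_fun xi F w None) (feasible Y (saa_fun xi F w) 0%E) x.
Hypotheses (sigmastar_gt0 : 0 < sigmastar) (sigma_gt0 : 0 < sigma).
Hypotheses (alpha_gt0 : 0 < alpha) (rho_ge0 : 0 <= rho) (t_ge0 : 0 <= t).
Hypothesis Y_bounded : exists B : R, forall x, Y x -> nrm x <= B.
Hypothesis F_good :
  goodness_over P xi nrm Y F (sigmastar ^+ 2) (sigma ^+ 2) alpha rho xstar Y.

Lemma prob_Good : prob_ge Pr (Good P xi nrm Y F sigmastar sigma alpha eps0 t)
  (1 - expR (- t) - 2 * (#|I|%:R + 1) * rho).
Proof.
have Yx : Y xstar by case: F_good => -[].
have n0 := ler0n R #|I|.
have bound_le : (#|I|.+1)%:R *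
    (4 * expR (- log_term (I := I) t) + 2 * rho) <=
    expR (- t) + 2 * (#|I|%:R + 1) * rho.
  rewrite mulrDr; apply: lerD; first exact: expRN_log_term.
  by rewrite -natr1; lra.
have [gfin|ginf] := ltP (gamma2 alpha (normd nrm) Y) +oo%E; last first.
  (* If the chaining functional is infinite there is nothing to chain, but then the good event is
     everything. *)
  exists setT; split => //; last first.
    rewrite probability_setT lee_fin.
    have := expR_ge0 (- t); have := rho_ge0; nra.
  move=> w _; apply: (Good_of_infinite_r_hat eps0 xstar_min (saa_min w) (ltW sigmastar_gt0)).
  by apply: r_hat_pinfty => //; apply/eqP; rewrite eq_le leey.
have [B YB] := Y_bounded.
have dlty := diam_normd_lty nrm_norm YB.
have Y0 : Y !=set0 by exists xstar.
have dfin := diam_fin_num (normd_ge0 nrm_norm) dlty Y0.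
case: F_good => _ _ xgood LF; case: F_car => mF _.
have event i : exists E : set Om, [/\ measurable E,
    (Pr E <= (4 * expR (- log_term (I := I) t) + 2 * rho)%:E)%E
  & forall w, ~ E w ->
    (forall x, Y x -> `|deviation P xi (F i) x w - deviation P xi (F i) xstar w| <=
      sigma / Num.sqrt N%:R *
        (4 * Num.sqrt 3 * fine (gamma2 alpha (normd nrm) Y) +
         6 * Num.sqrt 3 * Num.sqrt (log_term (I := I) t) *
           fine (diam (normd nrm) Y `^ alpha)%E)) /\
    `|deviation P xi (F i) xstar w| <=
      sigmastar * Num.sqrt (6 * log_term (I := I) t / N%:R)].
  have [L [Lgood FL]] := LF i.
  apply: (index_event N_gt0 xi_iid (L := L)) => //; first exact: log_term_ge1.
  - exact: normd_ge0.
  - exact: normdC.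
  - exact: mF.
  - exact: F_int.
have [E EP] := choice event.
pose Ebad : set Om := \big[setU/set0]_(i <- enum {: option I}) E i.
have [mE pE] : measurable Ebad /\ (Pr Ebad <= ((size (enum {: option I}))%:R *
    (4 * expR (- log_term (I := I) t) + 2 * rho))%:E)%E.
  by apply: measure_bigsetU_le => i _; case: (EP i).
exists (~` Ebad); split; first exact: measurableC.
  move=> w nE; have {}nE i : ~ E i w.
    by move=> Ew; apply: nE; rewrite /Ebad -bigcup_seq; exists i => //=; rewrite mem_enum.
  apply: (Good_of_deviation eps0 xstar_min (saa_min w) (ltW sigmastar_gt0) _
    (r_hat_fin (I := I) (N := N) sigma t gfin dfin)).
  - by rewrite -lee_fin -(r_hat_fin (I := I) (N := N) sigma t gfin dfin) r_hat_ge0.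
  - by move=> i x Yx'; have [_ _ /(_ w (nE i))[h _]] := EP i; exact: h.
  - by move=> i; have [_ _ /(_ w (nE i))[_ h]] := EP i; exact: h.
rewrite probability_setC//.
have : (Pr Ebad <= (expR (- t) + 2 * (#|I|%:R + 1) * rho)%:E)%E.
  apply: le_trans pE _; rewrite lee_fin.
  by rewrite -cardE card_option.
have : Pr Ebad \is a fin_num by exact: fin_num_measure.
case: (Pr Ebad) => [v| |] // _; rewrite -EFinB !lee_fin; lra.
Qed.

Lemma Good_dist_le (c : R) (w : Om) (x : 'rV[R]_d) : 0 < c ->
  metrically_regular nrm Y (mean_fun P F) c ->
  Good P xi nrm Y F sigmastar sigma alpha eps0 t w ->
  feasible Y (saa_fun xi F w) 0%E x ->
  (dist_to (normd nrm) (feasible Y (mean_fun P F) 0) x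
     <= c%:E * delta_hat nrm Y (I := I) (N := N) sigmastar sigma alpha t)%E.
Proof.
move=> c0 reg [feas _ _] xX; have [Yx fx] := feas x xX.
apply: le_trans (reg x Yx) _; rewrite EFinM; apply: lee_wpmul2l.
  by rewrite lee_fin ltW.
(* The maximum of constraint violations starts at 0 and takes positive parts, so a bound on the
   constraints bounds it only if it is nonnegative. *)
have d0 := delta_hat_ge0 nrm Y (I := I) (N := N) alpha t sigmastar_gt0 sigma_gt0.
by elim/big_ind : _ => [//|y z hy hz|i _]; rewrite EFin_max ge_max ?hy ?hz ?fx ?d0.
Qed.

End GoodProbability.

Theorem theorem2 (R : realType) :
  exists c_bdg : R, 0 < c_bdg /\
  forall (d : nat) (nrm : 'rV[R]_d -> R) (I : finType)
    (dXi dOm : measure_display)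
    (Xi : measurableType dXi) (Om : measurableType dOm)
    (P : probability Xi R) (Pr : probability Om R)
    (N : nat) (xi : 'I_N -> {RV Pr >-> Xi})
    (Y : set 'rV[R]_d) (F : option I -> 'rV[R]_d -> Xi -> R)
    (xstar : 'rV[R]_d) (sigmastar sigma alpha : R),
  is_norm nrm ->
  (0 < N)%N ->
  iid_with_law P xi ->
  caratheodory Y F ->
  (forall i x, Y x -> P.-integrable setT (EFin \o F i x)) ->
  is_minimizer (mean_fun P F None) (feasible Y (mean_fun P F) 0%E) xstar ->
  (forall w, exists x,
     is_minimizer (saa_fun xi F w None) (feasible Y (saa_fun xi F w) 0%E) x) ->
  0 < sigmastar -> 0 < sigma -> 0 < alpha -> alpha <= 1 ->
  (exists B : R, forall x, Y x -> nrm x <= B) ->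
  forall rho : R,
  (0 < rho /\
     goodness_over P xi nrm Y F (sigmastar ^+ 2) (sigma ^+ 2) alpha rho xstar Y)
  \/
  (exists p kappa : R,
     [/\ 2 <= p, 1 <= kappa,
         greatness_over P nrm Y F (sigmastar ^+ 2) (sigma ^+ 2) alpha p kappa
           xstar Y
       & rho = (c_bdg * kappa * Num.sqrt (p / N%:R)) `^ p]) ->
  forall eps0 t : R, 0 <= eps0 -> 0 <= t ->
  prob_ge Pr (Good P xi nrm Y F sigmastar sigma alpha eps0 t)
    (1 - expR (- t) - 2 * (#|I|%:R + 1) * rho) /\
  (forall c : R, 0 < c -> metrically_regular nrm Y (mean_fun P F) c ->
   forall w, Good P xi nrm Y F sigmastar sigma alpha eps0 t w ->
   forall x, feasible Y (saa_fun xi F w) 0%E x ->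
     (dist_to (normd nrm) (feasible Y (mean_fun P F) 0) x
        <= c%:E * delta_hat nrm Y (I := I) (N := N) sigmastar sigma alpha t)%E).
Proof.
(* The factor 4 e^2 is 2 * (2 e) * e: the 2 pays for two exceptional events, 2 e normalizes the
   Chernoff exponent, and the last e absorbs the lower-order factors of both bounds. *)
exists (4 * expR 2); split; first by rewrite mulr_gt0 ?expR_gt0.
move=> d nrm I dXi dOm Xi Om P Pr N xi Y F xstar sigmastar sigma alpha.
move=> nrm_norm N0 iid car iF xmin saa_min ss0 s0 a0 _ bnd rho hyp eps0 t _ t0.
split; last by move=> c c0 reg w good x; exact: Good_dist_le good.
have [rho0 good] : 0 <= rho /\
    goodness_over P xi nrm Y F (sigmastar ^+ 2) (sigma ^+ 2) alpha rho xstar Y.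
  case: hyp => [[/ltW rho0 good]//|[p [kappa [p2 k1 great ->]]]].
  split; first exact: powR_ge0.
  by apply: sub_hoelder_over great => h;
    apply: (great_fun_good N0 iid) => //; rewrite exprn_gt0.
exact: prob_Good iF xmin saa_min ss0 s0 a0 rho0 t0 bnd good.
Qed.
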